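(* For every constant $C'>0$ and every $\varepsilon\ge0$ there exist constants $c_1>c_2>0$, $c_3>0$ and $M>0$, depending only on $C'$ and $\varepsilon$, such that for every positive integer $S$ and every integer $n\ge2$ with $\ln n\le C'(\ln S-\varepsilon)$, the estimator with $K=c_3\ln n$ (rounded down to an integer) satisfies $$\sup_{P,Q\in\mathcal{M}_S}\mathbb{E}_Q\Big[\big|\widehat d_{\varepsilon,K,c_1,c_2}(P\|Q_n)-d_\varepsilon(P\|Q)\big|^2\Big]\;\le\;M\,\frac{e^\varepsilon S}{n\ln n}.$$
   Context: $\mathcal{M}_S$ is the set of probability distributions on $[S]=\{1,\dots,S\}$; $x\wedge y=\min\{x,y\}$, $x\vee y=\max\{x,y\}$, $[x]^+=\max\{x,0\}$; $d_\varepsilon(P\|Q)=\sum_{i=1}^S[p_i-e^\varepsilon q_i]^+$. Sampling: $P=(p_1,\dots,p_S)$ is known. Two independent batches are drawn i.i.d. from $Q$, of independent sizes $N_1,N_2\sim\mathrm{Poi}(n)$; $\hat q_{i,j}$ is the number of samples in batch $j\in\{1,2\}$ equal to $i$, divided by $n$. So all $\hat q_{i,j}$ are independent and $n\hat q_{i,j}\sim\mathrm{Poi}(nq_i)$. $\mathbb{E}_Q$ is expectation over these samples. For $c_1\ge c'>0$ and $p\in[0,1]$, define the interval $U(p;c_1,c')=\big[0,\frac{(c_1+c')\ln n}{n}\big]$ if $p\le\frac{c_1e^\varepsilon\ln n}{n}$, and $U(p;c_1,c')=\Big[e^{-\varepsilon}p-\sqrt{\tfrac{c'e^{-\varepsilon}p\ln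 n}{n}},\,e^{-\varepsilon}p+\sqrt{\tfrac{c'e^{-\varepsilon}p\ln n}{n}}\Big]$ otherwise. $D_K(x;p)$ is the best uniform approximation on the interval $U(p;c_1,c_1)$ of the function $x\mapsto[p-e^\varepsilon x]^+$ by polynomials in $x$ of degree at most $K$. Writing $D_K(x;p)=\sum_{j=0}^K b_jx^j$, set $\tilde D_K(\hat q;p)=\sum_{j=0}^K b_j\prod_{k=0}^{j-1}\big(\hat q-\frac kn\big)$; this is the unique unbiased (minimum variance) estimator of $D_K(q;p)$ based on $n\hat q\sim\mathrm{Poi}(nq)$. The estimator: for each $i\in[S]$ let $\delta_i=0$ if $\hat q_{i,1}$ is larger than the right endpoint of $U(p_i;c_1,c_2)$; $\delta_i=\tilde D_K(\hat q_{i,2};p_i)$ if $\hat q_{i,1}\in U(p_i;c_1,c_2)$; and $\delta_i=[p_i-e^\varepsilon\hat q_{i,2}]^+$ if $\hat q_{i,1}$ is smaller than the left endpoint of $U(p_i;c_1,c_2)$. Then $\widehat d_{\varepsilon,K,c_1,c_2}(P\|Q_n)=0\vee\big(1\wedge\sum_{i=1}^S\delta_i\big)$. *)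

(* Defs.v *)
From HB Require Import structures.
From mathcomp Require Import all_boot all_order all_algebra.
From mathcomp Require Import all_classical all_reals all_analysis.

Set Implicit Arguments.
Unset Strict Implicit.
Unset Printing Implicit Defensive.
Import Order.TTheory GRing.Theory Num.Theory.
Import numFieldNormedType.Exports.

Local Open Scope classical_set_scope.
Local Open Scope ring_scope.

Record probvec (R : realType) (S : nat) := ProbVec {
  prob_of :> 'I_S -> R ;
  prob_of_ge0 : forall i, 0 <= prob_of i ;
  prob_of_sum1 : \sum_i prob_of i = 1 }.

Definition eps_div (R : realType) (eps : R) (S : nat) (P Q : probvec R S) : R :=
  \sum_i Num.max (P i - expR eps * Q i) 0.

(** A batch is the finite list of the drawn symbols; its random size is the
    length of the list. *)
Definition batch (S : nat) := seq 'I_S.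

HB.instance Definition _ (S : nat) := Choice.on (batch S).
HB.instance Definition _ (S : nat) := isPointed.Build (batch S) [::].
HB.instance Definition _ (S : nat) :=
  @isMeasurable.Build default_measure_display (batch S) discrete_measurable
    discrete_measurable0 discrete_measurableC discrete_measurableU.

Section batch_law.
Context (R : realType) (S : nat) (Q : probvec R S) (n : nat).

(** Probability of observing exactly the list [s]: its size is Poisson([n])
    and, given the size, its entries are i.i.d. with law [Q]. *)
Definition batch_pmf (s : batch S) : R :=
  poisson_pmf n%:R (size s) * \prod_(x <- s) Q x.

(** The library's [poisson_pmf] is the Poisson mass function only for a positive
    rate; as in [poisson_prob], rate 0 is the point mass at 0. *)
Definition batch_law : set (batch S) -> \bar R := fun U =>
  if (0 < n)%N then \esum_(s in U) (batch_pmf s)%:E else \d_([::] : batch S) U.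

Lemma batch_pmf_ge0 s : 0 <= batch_pmf s.
Proof.
apply: mulr_ge0; first exact: poisson_pmf_ge0.
by apply: prodr_ge0 => x _; exact: prob_of_ge0.
Qed.

Let batch_law0 : batch_law set0 = 0%E.
Proof. by rewrite /batch_law measure0; case: ifPn => //; rewrite esum_set0. Qed.

Let batch_law_ge0 U : (0 <= batch_law U)%E.
Proof.
rewrite /batch_law; case: ifPn => // _; apply: esum_ge0 => s _.
by rewrite lee_fin batch_pmf_ge0.
Qed.

Let batch_law_sigma_additive : semi_sigma_additive batch_law.
Proof.
move=> F mF tF mUF; rewrite /batch_law; case: ifPn => _; last first.
  exact: measure_semi_sigma_additive.
apply: cvg_toP.
  apply: ereal_nondecreasing_is_cvgn => a b ab.
  apply: lee_sum_nneg_natr => // k _ _.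
  by apply: esum_ge0 => /= ? _; exact: batch_pmf_ge0.
by rewrite nneseries_sum_bigcup// => i; rewrite lee_fin batch_pmf_ge0.
Qed.

HB.instance Definition _ := isMeasure.Build _ _ _ batch_law
  batch_law0 batch_law_ge0 batch_law_sigma_additive.

Lemma sum_tuple_prod m : \sum_(t : m.-tuple 'I_S) \prod_(x <- t) Q x = 1.
Proof.
transitivity (\prod_(i < m) \sum_(x : 'I_S) Q x); last first.
  by rewrite big1// => i _; exact: prob_of_sum1.
rewrite bigA_distr_bigA /=.
rewrite (reindex (fun t : m.-tuple 'I_S => [ffun i => tnth t i])) /=; last first.
  exists (fun f : {ffun 'I_m -> 'I_S} => [tuple f i | i < m]) => [t _|f _].
    by apply: eq_from_tnth => i; rewrite tnth_mktuple ffunE.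
  by apply/ffunP => i; rewrite ffunE tnth_mktuple.
apply: eq_bigr => t _; rewrite big_tuple.
by apply: eq_bigr => i _; rewrite ffunE.
Qed.

Lemma esum_batch_size m :
  \esum_(s in [set s : batch S | size s = m]) (batch_pmf s)%:E
    = (poisson_pmf n%:R m)%:E :> \bar R.
Proof.
rewrite (reindex_esum [set: m.-tuple 'I_S] _ (@tval m 'I_S)); last first.
  split=> [t _ /=|t u _ _ /val_inj//|s /= sm]; first exact: size_tuple.
  by exists (Tuple (introT eqP sm)).
rewrite esum_fset; first last.
- by move=> t _; rewrite lee_fin batch_pmf_ge0.
- exact: finite_finset.
have -> : [set: m.-tuple 'I_S] = [set` index_enum (m.-tuple 'I_S : finType)].
  by apply/seteqP; split=> // t _ /=; exact: mem_index_enum.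
rewrite -fsbig_seq ?index_enum_uniq// sumEFin.
congr (_%:E).
rewrite (eq_bigr (fun t : m.-tuple 'I_S =>
    poisson_pmf n%:R m * \prod_(x <- t) Q x)).
  by rewrite -mulr_sumr sum_tuple_prod mulr1.
by move=> t _; rewrite /batch_pmf size_tuple.
Qed.

Let batch_law_setT : batch_law [set: batch S] = 1%E.
Proof.
rewrite /batch_law; case: ifPn => n0; last by rewrite probability_setT.
have -> : [set: batch S] = \bigcup_m [set s : batch S | size s = m].
  by apply/seteqP; split=> // s _; exists (size s).
rewrite esum_bigcupT//; first last.
- by move=> s; rewrite lee_fin batch_pmf_ge0.
- by move=> i j _ _ [s [/= <- <-]].
under eq_esum do rewrite esum_batch_size.
transitivity (poisson_prob (n%:R : R) 0 [set: nat]).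
  by rewrite /poisson_prob ltr0n n0.
exact: probability_setT.
Qed.

HB.instance Definition _ :=
  @Measure_isProbability.Build _ _ R batch_law batch_law_setT.

End batch_law.

Section estimator.
Context (R : realType) (eps : R) (n : nat).

(** The endpoints of the interval [U(p; c1, c')]. *)
Definition U_left (c1 c' p : R) : R :=
  if p <= c1 * expR eps * ln n%:R / n%:R then 0
  else expR (- eps) * p - Num.sqrt (c' * expR (- eps) * p * ln n%:R / n%:R).

Definition U_right (c1 c' p : R) : R :=
  if p <= c1 * expR eps * ln n%:R / n%:R then (c1 + c') * ln n%:R / n%:R
  else expR (- eps) * p + Num.sqrt (c' * expR (- eps) * p * ln n%:R / n%:R).

Definition U (c1 c' p : R) : interval R := `[U_left c1 c' p, U_right c1 c' p].

Definition uniform_dist (A : set R) (f g : R -> R) : \bar R :=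
  ereal_sup [set `|f x - g x|%:E | x in A].

Definition best_uniform_approx (A : set R) (f : R -> R) (K : nat)
    (D : {poly R}) : Prop :=
  (size D <= K.+1)%N /\
  forall D' : {poly R}, (size D' <= K.+1)%N ->
    (uniform_dist A f (horner D) <= uniform_dist A f (horner D'))%E.

(** The best approximation of a continuous function on a nondegenerate compact
    interval exists and is unique (Chebyshev), so that [xget] selects it; the
    default 0 is then never used. *)
Definition D_poly (K : nat) (c1 p : R) : {poly R} :=
  xget 0 [set D | best_uniform_approx [set` U c1 c1 p]
                    (fun x => Num.max (p - expR eps * x) 0) K D].

Definition D_tilde (K : nat) (c1 p q : R) : R :=
  \sum_(j < K.+1) (D_poly K c1 p)`_j * \prod_(k < j) (q - k%:R / n%:R).

(** [q1] and [q2] are the empirical frequencies of one symbol in the first and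
    second batch. *)
Definition delta (K : nat) (c1 c2 p q1 q2 : R) : R :=
  if U_right c1 c2 p < q1 then 0
  else if q1 \in U c1 c2 p then D_tilde K c1 p q2
  else Num.max (p - expR eps * q2) 0.

(** Normalized by the nominal size [n], not by the actual size of the batch. *)
Definition qhat (S : nat) (b : batch S) (i : 'I_S) : R :=
  (count_mem i b)%:R / n%:R.

Definition d_hat (S K : nat) (c1 c2 : R) (P : probvec R S)
    (b : batch S * batch S) : R :=
  Num.max 0 (Num.min 1
    (\sum_i delta K c1 c2 (P i) (qhat b.1 i) (qhat b.2 i))).

(** The expectation [E_Q] over two independent batches drawn from [Q]. *)
Definition mean_sq_error (S K : nat) (c1 c2 : R) (P Q : probvec R S) : \bar R :=
  ('E_(batch_law Q n \x batch_law Q n)[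
    (fun b => `|d_hat K c1 c2 P b - eps_div eps P Q|%R ^+ 2)%R])%E.

End estimator.

(* Main.v *)
(** Conditionally on the first batch, with high probability every symbol [i] is
    treated by a polynomial in its count in the second batch: 0, the unbiased
    estimator of the best approximation, or the linear plug-in without the
    clipping at 0.  Clipping the sum to [0, 1] makes the squared error at most 1,
    so the exceptional events only contribute their probability, which is
    [O(S / n^2)] by Chernoff bounds.  On the good event the counts are
    independent Poisson variables, and the mean squared error is a squared bias
    plus a sum of variances.

    Bias: in the variable [theta] with [x = m + w cos theta] the hinge
    [max (p - e^eps x) 0] is Lipschitz with constant [O(sqrt (e^eps p ln n / n))],
    so by Jackson's theorem it is approximated to within
    [O(sqrt (e^eps p / (n ln n)))] in degree [K]; Cauchy-Schwarz sums the biases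
    over the symbols.  Variance: a polynomial bounded by [B] on [-1, 1] has
    coefficients of sum at most [B e^(2K)], and the unbiased estimators of
    [(q - m)^j], which are Charlier polynomials, have second moment at most
    [2^j w^(2j)].  This loses a factor [e^(5K)], a small power of [n], which
    [S >= e^eps n^(1/C')] absorbs. *)

(* [D_poly] is given by minimality alone, so every fact about it comes from comparison with a
   competitor: the polynomial 0 controls its size, hence its coefficients, and an explicit
   construction controls its bias. Its existence must be proved, since otherwise the choice operator
   would return its default. The first batch locates [q] only up to sampling noise. It is therefore
   tested against the inner interval [U c1 c2 p], while the approximation holds on the outer
   interval [U c1 c1 p]; the margin between the two is what the Chernoff bounds consume. The
   Charlier polynomials are centered at the known middle of the interval and not at the unknown
   mean. Their moments stay under control because the squared radius, measured in counts, is at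
   least the mean times the degree: this ties the radius [sqrt (c1 * L * m)] to a degree of order
   [ln n]. Independence of the counts is needed only against polynomials, so it is proved as a
   product formula for factorial moments. *)
Require Import Defs.
From mathcomp Require Import all_boot all_order all_algebra.
From mathcomp Require Import ring lra.
From mathcomp Require Import all_classical all_reals all_analysis.
Import Order.TTheory GRing.Theory Num.Theory.
Import numFieldNormedType.Exports.
Local Open Scope classical_set_scope.
Local Open Scope ring_scope.

Set Implicit Arguments.
Unset Strict Implicit.
Unset Printing Implicit Defensive.

(** * Approximation of a hinge *)

Section jackson.
Context {R : realType}.
Implicit Types (x y t h : R).

Lemma normr_sin_le x : `|sin x| <= `|x|.
Proof.
have pos t : 0 <= t -> `|sin t| <= t.
  rewrite le_eqVlt => /predU1P[<-|t0]; first by rewrite sin0 normr0.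
  have [c _] := @MVT R sin cos 0 t t0 (fun u _ => is_derive_sin u)
    (continuous_subspaceT (@continuous_sin R)).
  rewrite sin0 !subr0 => ->; rewrite normrM (gtr0_norm t0).
  by rewrite ler_piMl ?(ltW t0)// cos_max.
have [x0|x0] := leP 0 x; first exact: le_trans (pos _ x0) (ler_norm _).
rewrite -normrN -sinN -[leRHS]normrN.
by rewrite (le_trans (pos _ _) (ler_norm _))// oppr_ge0 ltW.
Qed.

Lemma one_sub_cos_le x : 1 - cos x <= x ^+ 2 / 2.
Proof.
have -> : cos x = 1 - (sin (x / 2)) ^+ 2 *+ 2.
  by rewrite -{1}[x](@divfK _ 2)// mulr_natr cos_mulr2n cos2sin2; ring.
have : sin (x / 2) ^+ 2 <= (x / 2) ^+ 2.
  by rewrite -real_normK ?num_real// -[leRHS]real_normK ?num_real//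
    lerXn2r ?nnegrE ?normr_ge0 ?normr_sin_le.
by rewrite expr_div_n; lra.
Qed.

Lemma cosM2 x y : cos x * cos y *+ 2 = cos (x - y) + cos (x + y).
Proof. by rewrite cosB cosD; ring. Qed.

Definition node (N k : nat) : R := 2 * pi * k%:R / N%:R.

Lemma sum_cos_node (N m : nat) x : (0 < m < N)%N ->
  \sum_(k < N) cos (x + m%:R * node N k) = 0.
Proof.
move=> /andP[m0 mN].
have N0 : (N%:R : R) != 0 by rewrite pnatr_eq0; case: N mN.
pose h : R := m%:R * pi / N%:R.
have sh : sin h != 0.
  rewrite gt_eqF// sin_gt0_pi// /h; apply/andP; split.
    by rewrite !(mulr_gt0, invr_gt0, pi_gt0, ltr0n)//; case: N mN {N0 h}.
  rewrite mulrAC gtr_pMl ?pi_gt0// ltr_pdivrMr ?mul1r ?ltr_nat//.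
  by rewrite ltr0n; case: N mN {N0 h}.
apply: (mulfI sh); rewrite mulr0 mulr_sumr.
(* [sin h * cos (x + k * 2 h)] equals [g k.+1 - g k], so the sum telescopes; the two ends differ by
   [m] full turns. *)
pose g k := sin (x + k%:R * h *+ 2 - h) / 2.
transitivity (\sum_(0 <= k < N) (g k.+1 - g k)).
  rewrite big_mkord; apply: eq_bigr => k _; rewrite /g.
  have -> : x + k.+1%:R * h *+ 2 - h = (x + k%:R * h *+ 2) + h.
    by rewrite -natr1; ring.
  rewrite sinD sinB.
  have -> : m%:R * node N k = k%:R * h *+ 2 by rewrite /node /h; field.
  by field.
rewrite telescope_sumr// /g mul0r mul0rn addr0.
have -> : x + N%:R * h *+ 2 - h = (x - h) + (pi *+ 2) *+ m.
  by rewrite /h; field.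
by rewrite (periodicn (@sinD2pi R)) subrr.
Qed.

(** Discrete orthogonality: with [i] and [j] below [N], the frequency [i - j] is a multiple of [N]
    only if it is 0, so averaging over the nodes is as good as integrating over the circle. *)
Lemma sum_cos_diff (N i j : nat) x : (i < N)%N -> (j < N)%N ->
  \sum_(k < N) cos ((i%:R - j%:R) * (x - node N k)) = (i == j)%:R * N%:R.
Proof.
move=> iN jN.
have main (m : nat) : (0 < m < N)%N ->
    \sum_(k < N) cos (m%:R * (x - node N k)) = 0.
  move=> mN; rewrite -[RHS](sum_cos_node (- (m%:R * x)) mN).
  by apply: eq_bigr => k _; rewrite -cosN; congr cos; ring.
case: (ltngtP i j) => [ij|ij|->].
- rewrite mul0r -[RHS](main (j - i)%N); last first.
    by rewrite subn_gt0 ij (leq_ltn_trans (leq_subr _ _)).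
  by apply: eq_bigr => k _; rewrite -cosN natrB ?(ltnW ij)//; congr cos; ring.
- rewrite mul0r -[RHS](main (i - j)%N); last first.
    by rewrite subn_gt0 ij (leq_ltn_trans (leq_subr _ _)).
  by apply: eq_bigr => k _; rewrite natrB ?(ltnW ij)//.
- rewrite mul1r (eq_bigr (fun=> 1)) => [|k _].
    by rewrite sumr_const card_ord.
  by rewrite subrr mul0r cos0.
Qed.

(** Chebyshev polynomials of the first kind. Two consecutive ones are carried along so that the
    three-term recurrence is structural. *)
Fixpoint cheb (m : nat) : {poly R} * {poly R} :=
  if m is m'.+1 then ((cheb m').2, 'X * (cheb m').2 *+ 2 - (cheb m').1)
  else (1, 'X).

Lemma chebE m x : (cheb m).1.[cos x] = cos (m%:R * x) /\
  (cheb m).2.[cos x] = cos (m.+1%:R * x).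
Proof.
elim: m => [|m [IH1 IH2]] /=; first by rewrite hornerC mul0r cos0 mul1r hornerX.
split=> //; rewrite hornerD hornerN hornerMn hornerM hornerX IH1 IH2.
have -> : m.+2%:R * x = x + m.+1%:R * x by rewrite -[m.+2%:R]natr1; ring.
have -> : m%:R * x = m.+1%:R * x - x by rewrite -[m.+1%:R]natr1; ring.
by rewrite cosB cosD; ring.
Qed.

Lemma size_cheb m : (size (cheb m).1 <= m.+1)%N /\ (size (cheb m).2 <= m.+2)%N.
Proof.
elim: m => [|m [IH1 IH2]] /=; first by rewrite size_poly1 size_polyX.
split=> //; rewrite (leq_trans (size_polyD _ _))// geq_max size_polyN.
rewrite (leq_trans IH1) ?andbT; last by rewrite leqW.
rewrite mulr2n (leq_trans (size_polyD _ _))// maxnn.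
by rewrite (leq_trans (size_polyMleq _ _))// size_polyX.
Qed.

(** * The Fejer-Korovkin kernel on equispaced nodes *)

Section kernel.
Variable K : nat.
Let h : R := pi / K.+2%:R.
Let a (j : nat) : R := sin (j.+1%:R * h).
(** Multiplying the kernel by one more cosine brings indices up to [K.+1]; taking more nodes than
    that excludes aliasing. *)
Let N := K.+3.
Let c0 := \sum_(i < K.+1) a i ^+ 2.

(** In complex notation, the squared modulus of [\sum_i a i * exp (i * t)]. Among nonnegative cosine
    polynomials of degree [K] and given mean, these weights give the largest first Fourier
    coefficient; in this sense the kernel is the most concentrated near 0. *)
Definition fejer_korovkin t : R :=
  \sum_(i < K.+1) \sum_(j < K.+1) a i * a j * cos ((i%:R - j%:R) * t).
Local Notation J := fejer_korovkin.

Let h_gt0 : 0 < h.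
Proof. by rewrite /h divr_gt0 ?pi_gt0. Qed.

Lemma fejer_korovkin_ge0 t : 0 <= J t.
Proof.
have -> : J t = (\sum_(i < K.+1) a i * cos (i%:R * t)) ^+ 2
              + (\sum_(i < K.+1) a i * sin (i%:R * t)) ^+ 2.
  rewrite !expr2 !mulr_suml -big_split/=; apply: eq_bigr => i _.
  rewrite !mulr_sumr -big_split/=; apply: eq_bigr => j _.
  by rewrite mulrBl cosB; ring.
by rewrite addr_ge0// sqr_ge0.
Qed.

Let c0_gt0 : 0 < c0.
Proof.
rewrite /c0 big_ord_recl/= ltr_pwDl//; last by apply: sumr_ge0 => i _; rewrite sqr_ge0.
rewrite exprn_gt0// /a mul1r sin_gt0_pi// h_gt0 /h ltr_pdivrMr//.
by rewrite ltr_pMr ?pi_gt0// ltr1n.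
Qed.

Lemma sum_fejer_korovkin x : \sum_(k < N) J (x - node N k) = N%:R * c0.
Proof.
rewrite /J exchange_big/= mulr_sumr; apply: eq_bigr => i _.
rewrite exchange_big/= (bigD1 i)//= [X in _ + X]big1 => [|j ji].
  by rewrite -mulr_sumr sum_cos_diff ?eqxx ?mul1r ?(ltn_trans (ltn_ord i))// /N; ring.
rewrite -mulr_sumr sum_cos_diff ?(ltn_trans (ltn_ord _))//.
suff /negPf -> : i != j :> nat by rewrite mul0r mulr0.
by apply: contra ji => /eqP ij; apply/eqP/val_inj.
Qed.

(* The sequence [sin (i h)] is an eigenvector of the path with [K.+1] vertices,
   because it vanishes at both ends. *)
Lemma sum_neighbours (i : 'I_K.+1) :
  \sum_(j < K.+1) a j * ((i.+1 == j)%:R + (i == j.+1 :> nat)%:R)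
    = cos h * a i *+ 2.
Proof.
have -> : cos h * a i *+ 2 = sin (i.+2%:R * h) + sin (i%:R * h).
  have -> : i.+2%:R * h = i.+1%:R * h + h by rewrite -[i.+2%:R]natr1; ring.
  have -> : i%:R * h = i.+1%:R * h - h by rewrite -[i.+1%:R]natr1; ring.
  by rewrite sinB sinD /a; ring.
under eq_bigr do rewrite mulrDr.
rewrite big_split/=; congr (_ + _).
  have [iK|Ki] := ltnP i.+1 K.+1.
    rewrite (bigD1 (Ordinal iK))//= eqxx mulr1 big1 ?addr0// => j ji.
    suff /negPf -> : i.+1 != j :> nat by rewrite mulr0.
    by apply: contra ji => /eqP ij; apply/eqP/val_inj.
  rewrite big1; last first.
    move=> j _; suff /negPf -> : i.+1 != j :> nat by rewrite mulr0.
    by rewrite gtn_eqF// (leq_trans (ltn_ord j)).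
  have -> : i = K :> nat by apply/eqP; rewrite eqn_leq -ltnS ltn_ord.
  by rewrite /h mulrC divfK ?sinpi.
case: i => -[|i] ile /=.
  by rewrite mul0r sin0 big1// => j _; rewrite mulr0.
rewrite (bigD1 (Ordinal (ltnW ile)))//= eqxx mulr1 big1 ?addr0// => j ji.
suff /negPf -> : i.+1 != j.+1 :> nat by rewrite mulr0.
by rewrite eqSS; apply: contra ji => /eqP ij; apply/eqP/val_inj.
Qed.

(** The factor [cos] shifts one index up or down: the quadratic form of the identity becomes that of
    half the adjacency matrix of the path, of which [a] is an eigenvector with eigenvalue
    [cos h]. *)
Lemma sum_fejer_korovkin_cos x :
  \sum_(k < N) J (x - node N k) * cos (x - node N k) = N%:R * c0 * cos h.
Proof.
under eq_bigr do rewrite /J mulr_suml; rewrite exchange_big/=.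
have -> : N%:R * c0 * cos h = \sum_(i < K.+1) a i ^+ 2 * cos h * N%:R.
  by rewrite /c0 -mulrA mulrC !mulr_suml.
apply: eq_bigr => i _.
under eq_bigr do rewrite mulr_suml; rewrite exchange_big/=.
transitivity (\sum_(j < K.+1) a i * a j *
    ((i.+1 == j)%:R + (i == j.+1 :> nat)%:R) * N%:R / 2).
  apply: eq_bigr => j _.
  have e k : a i * a j * cos ((i%:R - j%:R) * (x - node N k)) * cos (x - node N k)
     = a i * a j / 2 * cos ((i%:R - j.+1%:R) * (x - node N k))
     + a i * a j / 2 * cos ((i.+1%:R - j%:R) * (x - node N k)).
    set t := x - _; rewrite -mulrDr.
    have -> : (i%:R - j.+1%:R) * t = (i%:R - j%:R) * t - t by rewrite -natr1; ring.
    have -> : (i.+1%:R - j%:R) * t = (i%:R - j%:R) * t + t by rewrite -natr1; ring.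
    by rewrite -cosM2; field.
  under eq_bigr do rewrite e.
  have ltN (l : 'I_K.+1) : (l < N)%N && (l.+1 < N)%N.
    by have lK := ltn_ord l; rewrite /N ltnS (leqW (ltnW lK)) ltnS (leqW lK).
  have /andP[iN SiN] := ltN i; have /andP[jN SjN] := ltN j.
  by rewrite big_split/= -!mulr_sumr !sum_cos_diff//; field.
rewrite (eq_bigr (fun j : 'I_K.+1 => a j * ((i.+1 == j)%:R + (i == j.+1 :> nat)%:R)
  * (a i * N%:R / 2))); last by move=> j _; field.
by rewrite -mulr_suml sum_neighbours; field.
Qed.

Lemma fejer_korovkinN t : J (- t) = J t.
Proof.
by apply: eq_bigr => i _; apply: eq_bigr => j _; rewrite mulrN cosN.
Qed.

(** [2 * (1 - cos t)] is the squared chord. Its kernel average is [2 * (1 - cos h) <= h ^+ 2], and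
    the inequality of means with weight [h] passes from the square to the chord itself. *)
Lemma sum_fejer_korovkin_chord x : \sum_(k < N)
  Num.sqrt (2 * (1 - cos (x - node N k))) * J (x - node N k) <= N%:R * c0 * h.
Proof.
have amgm u : 0 <= u -> Num.sqrt u <= h / 2 + u / (2 * h).
  move=> u0; rewrite -{2}(sqr_sqrtr u0) -subr_ge0.
  have -> : h / 2 + Num.sqrt u ^+ 2 / (2 * h) - Num.sqrt u
          = (h - Num.sqrt u) ^+ 2 / (2 * h) by field; rewrite gt_eqF.
  by rewrite divr_ge0 ?sqr_ge0// mulr_ge0// ltW.
apply: (@le_trans _ _ (\sum_(k < N) ((h / 2 + h^-1) * J (x - node N k)
     - h^-1 * (J (x - node N k) * cos (x - node N k))))).
  apply: ler_sum => k _; set t := x - _.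
  have t0 : 0 <= 2 * (1 - cos t) by rewrite mulr_ge0// subr_ge0 cos_le1.
  apply: (le_trans (ler_wpM2r (fejer_korovkin_ge0 t) (amgm _ t0))).
  rewrite le_eqVlt; apply/orP; left; apply/eqP.
  by field; rewrite gt_eqF.
rewrite big_split/= sumrN -!mulr_sumr sum_fejer_korovkin sum_fejer_korovkin_cos.
have -> : (h / 2 + h^-1) * (N%:R * c0) - h^-1 * (N%:R * c0 * cos h)
    = N%:R * c0 * (h / 2 + (1 - cos h) / h) by ring.
rewrite ler_wpM2l ?mulr_ge0 ?(ltW c0_gt0)//.
have : (1 - cos h) / h <= h / 2.
  by rewrite ler_pdivrMr//; have := one_sub_cos_le h; lra.
by lra.
Qed.

(* The polynomial is a discrete convolution of [f \o cos] with the kernel;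
   averaging over [x] and [- x] leaves only the cosines [cos (m x)]. *)
Lemma jackson (f : R -> R) (l : R) : 0 <= l ->
  (forall x y, `|f (cos x) - f (cos y)|
     <= l * Num.sqrt (2 * (1 - cos (x - y)))) ->
  exists2 P : {poly R}, (size P <= K.+1)%N &
    forall x, `|f (cos x) - P.[cos x]| <= l * (pi / K.+2%:R).
Proof.
move=> l0 fl.
(* This is the distance of [i] and [j]: one of the truncated differences is 0. *)
pose d (i j : nat) := ((i - j) + (j - i))%N.
have cosd (i j : nat) x : cos ((d i j)%:R * x) = cos ((i%:R - j%:R) * x).
  rewrite /d; have [ij|/ltnW ij] := leqP i j.
    rewrite (eqP ij) add0n natrB// -cosN; congr cos; ring.
  by rewrite (eqP ij) addn0 natrB.
pose P := (N%:R * c0)^-1 *: \sum_(k < N) f (cos (node N k)) *: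
  \sum_(i < K.+1) \sum_(j < K.+1)
     (a i * a j * cos ((i%:R - j%:R) * node N k)) *: (cheb (d i j)).1.
exists P.
  rewrite (leq_trans (size_scale_leq _ _))// (leq_trans (size_sum _ _ _))//.
  apply/bigmax_leqP => k _; rewrite (leq_trans (size_scale_leq _ _))//.
  rewrite (leq_trans (size_sum _ _ _))//; apply/bigmax_leqP => i _.
  rewrite (leq_trans (size_sum _ _ _))//; apply/bigmax_leqP => j _.
  rewrite (leq_trans (size_scale_leq _ _))// (leq_trans (size_cheb _).1)// ltnS.
  rewrite /d; have [ij|/ltnW ij] := leqP i j; rewrite (eqP ij).
    by rewrite add0n (leq_trans (leq_subr _ _))// -ltnS.
  by rewrite addn0 (leq_trans (leq_subr _ _))// -ltnS.
move=> x.
have PE : P.[cos x] = (2 * (N%:R * c0))^-1 * \sum_(k < N)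
   f (cos (node N k)) * (J (x - node N k) + J (- x - node N k)).
  rewrite hornerZ [in RHS]invfM [2^-1 * _]mulrC -mulrA; congr (_ * _).
  rewrite mulr_sumr horner_sum; apply: eq_bigr => k _.
  rewrite hornerZ mulrCA; congr (_ * _).
  rewrite -[- x - _]opprD fejer_korovkinN -big_split/= mulr_sumr horner_sum.
  apply: eq_bigr => i _; rewrite -big_split/= mulr_sumr horner_sum.
  apply: eq_bigr => j _; rewrite hornerZ (chebE _ _).1 cosd -mulrDr.
  by rewrite [_ * (x - _)]mulrBr [_ * (x + _)]mulrDr -cosM2; field.
have Nc0 : 0 < N%:R * c0 by rewrite mulr_gt0.
have fE : f (cos x) = (2 * (N%:R * c0))^-1 * \sum_(k < N)
   f (cos x) * (J (x - node N k) + J (- x - node N k)).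
  rewrite -mulr_sumr big_split/= !sum_fejer_korovkin.
  by set z := N%:R * c0 in Nc0 *; field; rewrite gt_eqF.
rewrite PE {1}fE -mulrBr -sumrB normrM ger0_norm ?invr_ge0 ?mulr_ge0 ?(ltW c0_gt0)//.
rewrite ler_pdivrMl ?mulr_gt0//.
apply: (le_trans (ler_norm_sum _ _ _)).
have := sum_fejer_korovkin_chord x.
have := sum_fejer_korovkin_chord (- x).
set B1 := \sum_(k < N) _; set B2 := \sum_(k < N) _ => B1le B2le.
apply: (@le_trans _ _ (l * (B1 + B2))); last first.
  have -> : 2 * (N%:R * c0) * (l * (pi / K.+2%:R))
    = l * (N%:R * c0 * h + N%:R * c0 * h) by rewrite /h; ring.
  by rewrite ler_wpM2l// lerD.
rewrite -big_split mulr_sumr/=; apply: ler_sum => k _.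
rewrite -mulrBl mulrDr (le_trans (ler_normD _ _))// addrC mulrDr; apply: lerD.
  rewrite normrM (ger0_norm (fejer_korovkin_ge0 _)) mulrA.
  by rewrite ler_wpM2r ?fejer_korovkin_ge0// fl.
rewrite normrM (ger0_norm (fejer_korovkin_ge0 _)) mulrA.
by rewrite ler_wpM2r ?fejer_korovkin_ge0// -[cos x]cosN fl.
Qed.

End kernel.

(** The hinge moves only where [c <= y0], and there the sine, which is the speed of the cosine, is
    at most [sqrt (1 - y0 ^+ 2)]. The gain over the plain Lipschitz constant matters for [y0] near
    -1, that is for small [p]. Angles appear as points [(c, s)] and [(d, t)] of the unit circle, so
    that only algebra is left. *)
Lemma hinge_chord (y0 c s d t : R) : -1 <= y0 <= 0 ->
  c ^+ 2 + s ^+ 2 = 1 -> d ^+ 2 + t ^+ 2 = 1 ->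
  (Num.max (y0 - c) 0 - Num.max (y0 - d) 0) ^+ 2
    <= 4 * (1 - y0 ^+ 2) * ((c - d) ^+ 2 + (s - t) ^+ 2).
Proof.
move=> /andP[y1 y2]; wlog cd : c s d t / c <= d => [hw|cs dt].
  have [cd|/ltW dc] := leP c d; first exact: hw.
  move=> cs dt; have := hw d t c s dc dt cs.
  by rewrite -sqrrN opprB -[(d - c) ^+ 2]sqrrN opprB -[(t - s) ^+ 2]sqrrN opprB.
have lip : (Num.max (y0 - c) 0 - Num.max (y0 - d) 0) ^+ 2 <= (c - d) ^+ 2.
  rewrite -ler_sqrt ?sqr_ge0// !sqrtr_sqr.
  rewrite [`|c - d|]ler0_norm ?subr_le0// ger0_norm.
    by case: (leP (y0 - c) 0) => ?; case: (leP (y0 - d) 0) => ?; lra.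
  by case: (leP (y0 - c) 0) => ?; case: (leP (y0 - d) 0) => ?; lra.
have st0 := sqr_ge0 (s - t); have cd0 := sqr_ge0 (c - d).
(* Here [4 * (1 - y0 ^+ 2)] is at least 3, so the plain Lipschitz bound suffices. *)
have [y3|y3] := leP (- (1 / 2)) y0.
  apply: (le_trans lip).
  have : y0 ^+ 2 <= 1 / 4 by nra.
  by nra.
have [cy|yc] := leP c y0; last first.
  rewrite !max_r; try lra.
  rewrite subrr expr0n/= mulr_ge0 ?addr_ge0//.
  by rewrite mulr_ge0//; nra.
have y4 : 0 <= 1 - y0 ^+ 2 by nra.
have [dy|yd] := leP d y0.
  apply: (le_trans lip).
  (* Both points are in the active part. As [c] and [d] are below -1/2, [|c + d| >= 1], and the
     equation of the circle turns [(c - d) * (c + d)] into [(t - s) * (t + s)], whose last factor is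
     small. *)
  have H : (c - d) ^+ 2 * (c + d) ^+ 2 = (s - t) ^+ 2 * (s + t) ^+ 2.
    by rewrite -!exprMn -!subr_sqr -[c ^+ 2](addrK (s ^+ 2)) cs
      -[d ^+ 2](addrK (t ^+ 2)) dt; ring.
  have H1 : 1 <= (c + d) ^+ 2 by nra.
  have H2 : (s + t) ^+ 2 <= 4 * (1 - y0 ^+ 2).
    have : (s + t) ^+ 2 <= 2 * (s ^+ 2 + t ^+ 2) by have := sqr_ge0 (s - t); nra.
    by nra.
  have : (c - d) ^+ 2 <= (c - d) ^+ 2 * (c + d) ^+ 2 by rewrite ler_peMr.
  rewrite H => /le_trans; apply; rewrite [leLHS]mulrC.
  apply: (@le_trans _ _ (4 * (1 - y0 ^+ 2) * (s - t) ^+ 2)); first by rewrite ler_wpM2r.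
  by rewrite ler_wpM2l ?mulr_ge0// lerDr.
rewrite max_l ?subr_ge0// max_r ?subr_le0 ?(ltW yd)// subr0.
(* Only [c] is active. If [d] exceeds [- y0], the points are at distance at least 1; otherwise
   [|s| <= s0 <= |t|], and the difference of the sines controls [y0 - c <= s0 ^+ 2 - s ^+ 2]. *)
have [dy|yd'] := leP d (- y0); last first.
  have H1 : 1 <= (c - d) ^+ 2 by nra.
  have H2 : (y0 - c) ^+ 2 <= 1 - y0 ^+ 2 by nra.
  apply: (le_trans H2); nra.
pose s0 := Num.sqrt (1 - y0 ^+ 2).
have s02 : s0 ^+ 2 = 1 - y0 ^+ 2 by rewrite sqr_sqrtr.
have s0ge : 0 <= s0 by rewrite sqrtr_ge0.
rewrite -s02.
have ss : `|s| <= s0.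
  rewrite -(ger0_norm s0ge) -ler_sqr ?nnegrE ?normr_ge0// !real_normK ?num_real//.
  by nra.
have tt : s0 <= `|t|.
  rewrite -[leLHS](ger0_norm s0ge) -ler_sqr ?nnegrE ?normr_ge0// !real_normK ?num_real//.
  by nra.
have s2 : `|s| ^+ 2 = s ^+ 2 by rewrite real_normK ?num_real.
have H1 : y0 - c <= 2 * s0 * (s0 - `|s|).
  have : y0 - c <= s0 ^+ 2 - `|s| ^+ 2 by rewrite s02 s2; nra.
  have := normr_ge0 s; nra.
have H2 : 0 <= s0 - `|s| <= `|s - t|.
  rewrite subr_ge0 ss/= distrC; apply: le_trans (lerB_dist t s).
  by rewrite lerD2r.
have H3 : (s - t) ^+ 2 = `|s - t| ^+ 2 by rewrite real_normK ?num_real.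
apply: (@le_trans _ _ ((2 * s0 * (s0 - `|s|)) ^+ 2)).
  by rewrite lerXn2r ?nnegrE ?subr_ge0// mulr_ge0// ?mulr_ge0// subr_ge0.
rewrite !exprMn -natrX.
apply: ler_wpM2l; first by rewrite mulr_ge0 ?sqr_ge0.
rewrite H3; apply: (@le_trans _ _ (`|s - t| ^+ 2)); last by rewrite lerDr.
by case/andP: H2 => H2 H2'; rewrite lerXn2r ?nnegrE ?normr_ge0.
Qed.

Lemma hinge_approx (y0 : R) (K : nat) : -1 <= y0 <= 0 ->
  exists2 P : {poly R}, (size P <= K.+1)%N &
    forall y, -1 <= y <= 1 ->
      `|Num.max (y0 - y) 0 - P.[y]|
         <= 2 * Num.sqrt (1 - y0 ^+ 2) * (pi / K.+2%:R).
Proof.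
move=> y0b.
have [||P sP HP] := @jackson K (fun y => Num.max (y0 - y) 0)
    (2 * Num.sqrt (1 - y0 ^+ 2)).
- by rewrite mulr_ge0 ?sqrtr_ge0.
- move=> x y.
  have := hinge_chord y0b (cos2Dsin2 x) (cos2Dsin2 y).
  have -> : (cos x - cos y) ^+ 2 + (sin x - sin y) ^+ 2 = 2 * (1 - cos (x - y)).
    have := cos2Dsin2 x; have := cos2Dsin2 y; rewrite cosB.
    set a := cos x; set b := cos y; set u := sin x; set v := sin y => E1 E2.
    have -> : (a - b) ^+ 2 + (u - v) ^+ 2
       = (a ^+ 2 + u ^+ 2) + (b ^+ 2 + v ^+ 2) - 2 * (a * b + u * v) by ring.
    by rewrite E1 E2; ring.
  have y02 : 0 <= 1 - y0 ^+ 2 by case/andP: y0b => ? ?; nra.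
  have c0 : 0 <= 2 * (1 - cos (x - y)) by rewrite mulr_ge0// subr_ge0 cos_le1.
  rewrite -ler_sqrt ?mulr_ge0// sqrtr_sqr sqrtrM ?mulr_ge0// sqrtrM//.
  have -> : (4 : R) = 2 ^+ 2 by rewrite -natrX.
  by rewrite sqrtr_sqr [`|2|]ger0_norm.
exists P => // y yb; have yi : y \in `[(-1)%R, 1%R] by rewrite in_itv.
by have := HP (acos y); rewrite acosK.
Qed.
End jackson.

(** * Best uniform approximation *)

Section coefficients.
Context {R : realType}.

(** The majorant relation, stable under sums and products: the coefficients of a Lagrange basis
    polynomial are bounded by evaluating at 1 the majorant ['X + 1] of each factor. *)
Definition dominated (p q : {poly R}) := forall j, `|p`_j| <= q`_j.

Lemma dominatedM (p p' q q' : {poly R}) :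
  dominated p q -> dominated p' q' -> dominated (p * p') (q * q').
Proof.
move=> pq pq' j; rewrite !coefM (le_trans (ler_norm_sum _ _ _))//.
by apply: ler_sum => i _; rewrite normrM ler_pM ?normr_ge0.
Qed.

Lemma dominated_prod (I : finType) (P : pred I) (p q : I -> {poly R}) :
  (forall i, P i -> dominated (p i) (q i)) ->
  dominated (\prod_(i | P i) p i) (\prod_(i | P i) q i).
Proof.
move=> pq; apply: (big_ind2 dominated) => // [j|? ? ? ?]; last exact: dominatedM.
by rewrite coefC; case: eqP => _; rewrite ?normr0 ?normr1.
Qed.

Lemma dominated_sum (I : finType) (p q : I -> {poly R}) :
  (forall i, dominated (p i) (q i)) -> dominated (\sum_i p i) (\sum_i q i).
Proof.
move=> pq; apply: (big_ind2 dominated) => // [j|p1 q1 p2 q2 d1 d2 j].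
  by rewrite coef0 normr0.
by rewrite !coefD (le_trans (ler_normD _ _))// lerD.
Qed.

Lemma dominatedC (c d : R) : `|c| <= d -> dominated c%:P d%:P.
Proof. by move=> cd j; rewrite !coefC; case: eqP => _; rewrite ?normr0. Qed.

Lemma dominated_horner1 n (p q : {poly R}) : dominated p q ->
  \sum_(j < n) `|p`_j| <= q.[1].
Proof.
move=> pq; apply: (@le_trans _ _ (\sum_(j < n) q`_j)).
  by apply: ler_sum => i _; exact: pq.
have q0 j : 0 <= q`_j by apply: le_trans (pq j).
have [nq|/ltnW qn] := leqP n (size q).
  rewrite horner_coef (eq_bigr (fun i : 'I_(size q) => q`_i)); last first.
    by move=> i _; rewrite expr1n mulr1.
  rewrite -(subnKC nq) big_split_ord/= lerDl.
  by apply: sumr_ge0.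
rewrite (horner_coef_wide _ qn) le_eqVlt; apply/orP; left; apply/eqP.
by apply: eq_bigr => i _; rewrite expr1n mulr1.
Qed.

Lemma prod_dist_nat K i : (i <= K)%N ->
  \prod_(j < K.+1 | j != i :> nat) `|i%:R - j%:R| = (i`! * (K - i)`!)%:R :> R.
Proof.
elim: K => [|K IH].
  rewrite leqn0 => /eqP ->; rewrite big_pred0//.
  by move=> j; rewrite ord1.
rewrite leq_eqVlt => /predU1P[->|]; last first.
  rewrite ltnS => iK; rewrite big_mkcond big_ord_recr/= gtn_eqF//= -big_mkcond IH//.
  rewrite subSn// factS mulnCA [RHS]natrM mulrC; congr (_ * _).
  by rewrite distrC -natrB ?leqW// subSn// ger0_norm.
rewrite subnn fact0 muln1.
rewrite big_mkcond big_ord_recr/= eqxx mulr1.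
elim: (K.+1) => [|m IHm]; first by rewrite big_ord0.
rewrite big_ord_recl/= subr0 ger0_norm// factS natrM -IHm.
congr (_ * _); apply: eq_bigr => j _; rewrite /bump/= add1n eqSS.
by case: ifP => // _; rewrite -!natr1; congr `|_|; ring.
Qed.

(* Lagrange interpolation at [K.+1] equispaced points of [-1, 1]. *)
Lemma sum_coef_le (K : nat) (G : {poly R}) (B : R) : (0 < K)%N ->
  (size G <= K.+1)%N -> (forall y, -1 <= y <= 1 -> `|G.[y]| <= B) ->
  \sum_(j < K.+1) `|G`_j| <= B * expR (2 * K%:R).
Proof.
move=> K0 sG GB.
have KR : 0 < K%:R :> R by rewrite ltr0n.
pose y (i : nat) : R := 2 / K%:R * i%:R - 1.
have yb (i : 'I_K.+1) : -1 <= y i <= 1.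
  rewrite /y lerBrDr addrC subrr !mulr_ge0 ?invr_ge0//= lerBlDr.
  by rewrite mulrAC ler_pdivrMr// ler_wpM2l// ler_nat -ltnS.
have yI : injective y.
  move=> i j /addIr/mulfI; rewrite mulf_neq0 ?invr_eq0 ?gt_eqF// => /(_ isT).
  by move/eqP; rewrite eqr_nat => /eqP.
have B0 : 0 <= B by apply: le_trans (GB 0 _); rewrite ?normr_ge0//; lra.
pose c i : R := K%:R ^+ K / 2 ^+ K / (i`! * (K - i)`!)%:R.
have cE (i : 'I_K.+1) :
    `|\prod_(j < K.+1 | j != i) (y i - y j)|^-1 = c i.
  rewrite normr_prod.
  have -> : \prod_(j < K.+1 | j != i) `|y i - y j|
      = \prod_(j < K.+1 | j != i) (2 / K%:R) * \prod_(j < K.+1 | j != i) `|i%:R - j%:R|.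
    rewrite -big_split/=; apply: eq_bigr => j _.
    rewrite -[X in X * _]ger0_norm ?divr_ge0// -normrM; congr `|_|.
    by rewrite /y; ring.
  rewrite prod_dist_nat ?leq_ord// prodr_const cardC1 card_ord /= invfM.
  by rewrite /c expr_div_n invf_div.
rewrite (lagrange_gen (n:=K.+1) _ yI sG)//.
pose q : {poly R} := \sum_(i < K.+1) B%:P * ((c i)%:P * \prod_(j < K.+1 | j != i) ('X + 1)).
apply: (@le_trans _ _ q.[1]).
  apply: dominated_horner1; apply: dominated_sum => i.
  apply: dominatedM; first by apply: dominatedC; exact: GB.
  rewrite lagrangeE//=; apply: dominatedM.
    apply: dominatedC; rewrite horner_prod normfV; under eq_bigr do rewrite hornerXsubC.
    by rewrite cE.
  apply: dominated_prod => j _ k; rewrite coefB coefD !coefX !coefC.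
  case: k => [|[|k]] /=; rewrite ?sub0r ?add0r ?subr0 ?addr0 ?normrN ?normr1 ?normr0//.
  by rewrite ler_norml yb.
rewrite horner_sum.
under eq_bigr => i _.
  rewrite !hornerM !hornerC horner_prod.
  under eq_bigr do rewrite hornerD hornerX hornerC.
  rewrite prodr_const cardC1 card_ord /=.
  over.
rewrite -mulr_sumr ler_wpM2l//.
have cbin (i : 'I_K.+1) : c i * (1 + 1) ^+ K = K%:R ^+ K / K`!%:R * 'C(K, i)%:R.
  rewrite /c -[K`!](@bin_fact K i) ?leq_ord// !natrM.
  by field; rewrite !pnatr_eq0 -!lt0n !fact_gt0 bin_gt0 leq_ord/=.
under eq_bigr do rewrite cbin.
rewrite -mulr_sumr -natr_sum.
have -> : (\sum_(i < K.+1) 'C(K, i) = 2 ^ K)%N.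
  rewrite -[2%N]/(1 + 1)%N expnDn; apply: eq_bigr => i _.
  by rewrite !exp1n !muln1.
(* The remaining [(2 * K)^K / K!] is one term of the exponential series of [2 * K]. *)
case: K K0 {sG KR y yb yI c cE q cbin} => // K _.
have K2 : 0 <= 2 * K.+1%:R :> R by rewrite mulr_ge0.
apply: le_trans (expR_ge1Dxn K K2).
rewrite natrX mulrAC -exprMn [K.+1%:R * 2]mulrC.
by rewrite lerDr.
Qed.
End coefficients.

(** * Existence of a best approximation *)

Section best_approximation.
Context {R : realType}.

(** Compactness. The polynomial 0 has error at most [B0], so a competitor worth considering is
    bounded by [2 * B0] on the interval, and its coefficients lie in a fixed box by [sum_coef_le].
    The error is Lipschitz in the coefficients and attains its minimum on this box. *)
Lemma best_approx_exists (F : R -> R) (B0 : R) (K : nat) : (0 < K)%N ->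
  (forall y, -1 <= y <= 1 -> `|F y| <= B0) ->
  exists2 G : {poly R}, (size G <= K.+1)%N &
    forall (G' : {poly R}) e, (size G' <= K.+1)%N ->
      (forall y, -1 <= y <= 1 -> `|F y - G'.[y]| <= e) ->
      forall y, -1 <= y <= 1 -> `|F y - G.[y]| <= e.
Proof.
move=> K0 FB.
have B00 : 0 <= B0 by apply: le_trans (FB 0 _); rewrite ?normr_ge0//; lra.
pose P (v : 'rV[R]_K.+1) : {poly R} := rVpoly v.
pose err (v : 'rV[R]_K.+1) : set R :=
  [set `|F y - (P v).[y]| | y in [set y | -1 <= y <= 1]].
pose phi v := sup (err v).
have PB v y : -1 <= y <= 1 -> `|(P v).[y]| <= \sum_i `|v ord0 i|.
  move=> yb; rewrite (horner_coef_wide _ (size_poly _ _)).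
  rewrite (le_trans (ler_norm_sum _ _ _))//; apply: ler_sum => i _.
  rewrite coef_rVpoly_ord normrM normrX ler_piMr// exprn_ile1//.
  by rewrite ler_norml.
have err0 v : err v !=set0 by exists `|F 0 - (P v).[0]|; exists 0 => //=; lra.
have errub v : has_sup (err v).
  split=> //; exists (B0 + \sum_i `|v ord0 i|) => _ [y yb <-].
  by rewrite (le_trans (ler_normB _ _))// lerD ?FB ?PB.
have phi_ub v y : -1 <= y <= 1 -> `|F y - (P v).[y]| <= phi v.
  by move=> yb; apply: sup_upper_bound => //; exists y.
have phi_le v e : (forall y, -1 <= y <= 1 -> `|F y - (P v).[y]| <= e) -> phi v <= e.
  by move=> H; apply: ge_sup => // _ [y yb <-]; exact: H.
have phi_lip v v' : phi v <= phi v' + \sum_i `|v ord0 i - v' ord0 i|.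
  apply: phi_le => y yb.
  have -> : F y - (P v).[y] = (F y - (P v').[y]) - (P (v - v')).[y].
    by rewrite /P raddfB/= hornerD hornerN; ring.
  rewrite (le_trans (ler_normB _ _))// lerD ?phi_ub//.
  by rewrite (le_trans (PB _ _ yb))//; apply: ler_sum => i _; rewrite !mxE.
have phi_cont : continuous phi.
  move=> v; apply/(@cvgrPdist_le _ _ _ (nbhs v) (nbhs_filter v)) => e e0.
  apply/nbhs_ballP; exists (e / K.+1%:R) => [|v' vv'] /=; first exact: divr_gt0.
  have d : \sum_i `|v ord0 i - v' ord0 i| <= e.
    apply: (@le_trans _ _ (\sum_(i < K.+1) e / K.+1%:R)).
      apply: ler_sum => i _.
      have : `|v - v'| <= e / K.+1%:R.
        by move: vv'; rewrite -ball_normE /= => /ltW.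
      apply: le_trans.
      rewrite [leRHS]/Num.norm/= mx_normrE.
      by apply/bigmax_geP; right => /=; exists (ord0, i) => //=; rewrite !mxE.
    by rewrite sumr_const card_ord -[leLHS]mulr_natr divfK.
  have d' : \sum_i `|v' ord0 i - v ord0 i| <= e by under eq_bigr do rewrite distrC.
  by rewrite ler_norml; have := phi_lip v v'; have := phi_lip v' v; lra.
pose R0 := 2 * B0 * expR (2 * K%:R).
have R00 : 0 <= R0 by rewrite !mulr_ge0 ?expR_ge0.
pose A := [set v : 'rV[R]_K.+1 | forall i, v ord0 i \in `[- R0, R0]].
have cA : compact A.
  apply: (@rV_compact _ _ (fun=> `[- R0, R0]%classic)).
  by move=> _; exact: segment_compact.
have A0 : A 0 by move=> i; rewrite mxE in_itv/= oppr_le0 R00.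
have [|v vA vmin] := @compact_EVT_min _ R phi A (ex_intro _ 0 A0) cA.
  exact: continuous_subspaceT.
exists (P v); first exact: size_poly.
move=> G' e sG' HG' y yb.
apply: (le_trans (phi_ub _ _ yb)).
have [eB|Be] := leP e B0; last first.
  apply: ltW; apply: le_lt_trans Be.
  apply: (le_trans (vmin 0 _)); first by rewrite inE.
  by apply: phi_le => z zb; rewrite /P raddf0 horner0 subr0 FB.
have G'B z : -1 <= z <= 1 -> `|G'.[z]| <= 2 * B0.
  move=> zb; have -> : G'.[z] = F z - (F z - G'.[z]) by ring.
  rewrite (le_trans (ler_normB _ _))//.
  by have := FB z zb; have := HG' z zb; lra.
have sumB := sum_coef_le K0 sG' G'B.
have PG : P (poly_rV G') = G' by rewrite /P poly_rV_K.
apply: (le_trans (vmin (poly_rV G') _)); last by apply: phi_le => z zb; rewrite PG HG'.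
rewrite inE => i; rewrite mxE in_itv/= -ler_norml; apply: le_trans sumB.
by rewrite (bigD1 i)//= lerDl sumr_ge0.
Qed.

Lemma uniform_distP (A : set R) (f g : R -> R) (e : R) :
  (uniform_dist A f g <= e%:E)%E <-> forall x, A x -> `|f x - g x| <= e.
Proof.
split=> [H x Ax|H].
  by rewrite -lee_fin; apply: le_trans H; apply: ereal_sup_ubound; exists x.
by apply: ge_ereal_sup => _ [x Ax <-]; rewrite lee_fin H.
Qed.

Lemma size_comp_affine (p q : {poly R}) : (size q <= 2)%N -> (size (p \Po q) <= size p)%N.
Proof.
move=> sq; rewrite comp_polyE (leq_trans (size_sum _ _ _))//.
apply/bigmax_leqP => i _; rewrite (leq_trans (size_scale_leq _ _))//.
rewrite (leq_trans (size_poly_exp_leq _ _))//.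
have ip := ltn_ord i; have p0 := leq_ltn_trans (leq0n _) ip.
by case: (size q) sq => [|[|[|//]]] _; rewrite ?mul0n ?mul1n.
Qed.

Lemma best_uniform_approx_exists (m w : R) (f : R -> R) (B0 : R) (K : nat) :
  0 < w -> (0 < K)%N -> (forall x, m - w <= x <= m + w -> `|f x| <= B0) ->
  exists D, best_uniform_approx `[m - w, m + w]%classic f K D.
Proof.
move=> w0 K0 fB.
have wN : w != 0 by rewrite gt_eqF.
have inv y : -1 <= y <= 1 -> m - w <= m + w * y <= m + w.
  by move=> /andP[y1 y2]; nra.
have [|G sG HG] := @best_approx_exists (fun y => f (m + w * y)) B0 K K0.
  by move=> y yb; apply: fB; exact: inv.
pose aff : {poly R} := w^-1 *: ('X - m%:P).
pose iaff : {poly R} := w *: 'X + m%:P.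
have affE x : aff.[x] = (x - m) / w by rewrite /aff hornerZ hornerXsubC mulrC.
exists (G \Po aff); split.
  rewrite (leq_trans (size_comp_affine _ _))// (leq_trans (size_scale_leq _ _))//.
  by rewrite size_XsubC.
move=> D' sD'; set A := [set` _].
case E : (uniform_dist _ f (horner D')) => [e| |]; last 2 first.
- exact: leey.
- have : (`|f m - D'.[m]|%R%:E <= uniform_dist A f (horner D'))%E.
    by apply: ereal_sup_ubound; exists m => //; rewrite /A /= in_itv/=; lra.
  by rewrite E leeNy_eq.
have /uniform_distP H : (uniform_dist A f (horner D') <= e%:E)%E.
  by rewrite E.
apply/uniform_distP => x; rewrite /A /= in_itv/= => /andP[x1 x2].
have := HG (D' \Po iaff) e _ _ ((x - m) / w).
rewrite horner_comp affE [w * _]mulrC divfK//= [m + _]addrC subrK; apply.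
- rewrite (leq_trans (size_comp_affine _ _))// (leq_trans (size_polyD _ _))// geq_max.
  by rewrite (leq_trans (size_scale_leq _ _)) ?size_polyX// (leq_trans (size_polyC_leq1 _)).
- move=> y yb; rewrite horner_comp hornerD hornerZ hornerX hornerC [_ + m]addrC.
  by apply: H; rewrite /A /= in_itv/= inv.
- by rewrite ler_pdivlMr// ler_pdivrMr//; lra.
Qed.
End best_approximation.

(** * Counts in a Poissonized batch *)

Section poisson_sums.
Context {R : realType}.
Implicit Type r : R.

Lemma sum_poisson_pmf r : 0 < r -> (\sum_(m <oo) (poisson_pmf r m)%:E)%E = 1%E.
Proof.
move=> r0; rewrite nneseries_esumT; last by move=> m; rewrite lee_fin poisson_pmf_ge0.
transitivity (poisson_prob r 0 [set: nat]); first by rewrite /poisson_prob r0.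
exact: probability_setT.
Qed.

Lemma sum_poisson_pmf_exp r z : 0 < r -> 0 < z ->
  (\sum_(m <oo) (poisson_pmf r m * z ^+ m)%:E)%E = (expR (r * (z - 1)))%:E.
Proof.
move=> r0 z0; have rz0 : 0 < r * z by rewrite mulr_gt0.
rewrite (eq_eseriesr (g := fun m =>
    ((expR (r * (z - 1)))%:E * (poisson_pmf (r * z) m)%:E)%E)); last first.
  move=> m _; rewrite -EFinM /poisson_pmf r0 rz0 exprMn mulrBr mulr1 expRD.
  rewrite [expR (- (r * z))]expRN; congr _%:E; field.
  by rewrite pnatr_eq0 -lt0n fact_gt0 expR_eq0.
rewrite nneseriesZl; last by move=> m _; rewrite lee_fin poisson_pmf_ge0.
by rewrite sum_poisson_pmf// mule1.
Qed.

Lemma sum_poisson_pmf_bin r k : 0 < r ->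
  (\sum_(m <oo) (poisson_pmf r m * 'C(m, k)%:R)%:E)%E = (r ^+ k / k`!%:R)%:E.
Proof.
move=> r0; have ge0 j m : (0%:E <= (poisson_pmf r m * 'C(m, j)%:R)%:E)%E.
  by rewrite lee_fin mulr_ge0 ?poisson_pmf_ge0.
elim: k => [|k IH].
  rewrite expr0 fact0 divr1 -(sum_poisson_pmf r0).
  by apply: eq_eseriesr => m _; rewrite bin0 mulr1.
rewrite nneseries_recl//; rewrite bin0n mulr0 add0e -(@nneseries_addn _ _ 1)//.
rewrite (eq_eseriesr (g := fun m =>
    ((r / k.+1%:R)%:E * (poisson_pmf r m * 'C(m, k)%:R)%:E)%E)); last first.
  move=> m _; rewrite addn1 -EFinM /poisson_pmf r0; congr _%:E.
  have e : 'C(m.+1, k.+1)%:R = m.+1%:R * 'C(m, k)%:R / k.+1%:R :> R.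
    by rewrite -natrM (mul_bin_diag m.+1 k) natrM mulrC mulKf ?pnatr_eq0.
  rewrite e factS natrM exprS; field.
  by rewrite ?nat1r !pnatr_eq0 -!lt0n fact_gt0.
rewrite nneseriesZl// IH -EFinM; congr _%:E.
rewrite factS natrM exprS; field.
by rewrite ?nat1r !pnatr_eq0 -!lt0n fact_gt0.
Qed.
End poisson_sums.

(** * Factorial moments and independence of the counts *)

Section batch_expectation.
Context {R : realType} {S : nat} (Q : probvec R S) (n : nat).
Hypothesis n_gt0 : (0 < n)%N.
Local Notation mu := (batch_law Q n).
Implicit Types (F : batch S -> R).

Let nR_gt0 : 0 < n%:R :> R. Proof. by rewrite ltr0n. Qed.

Lemma measurable_batch (D : set (batch S)) d' (T' : sigmaRingType d') (F : batch S -> T') :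
  measurable_fun D F.
Proof. by []. Qed.

Lemma batch_law_set1 s : mu [set s] = (batch_pmf Q n s)%:E.
Proof.
by rewrite /mu/= /batch_law n_gt0 esum_set1// lee_fin batch_pmf_ge0.
Qed.

Lemma integral_batch F : (forall s, 0 <= F s) ->
  (\int[mu]_s (F s)%:E)%E = (\sum_(m <oo) (poisson_pmf n%:R m *
     \sum_(t : m.-tuple 'I_S) F t * \prod_(x <- t) Q x)%:E)%E.
Proof.
move=> F0.
have -> : [set: batch S] = \bigcup_m [set s : batch S | size s = m].
  by apply/seteqP; split=> // s _; exists (size s).
rewrite ge0_integral_bigcup//; last 2 first.
- by move=> x _; rewrite lee_fin.
- by move=> i j _ _ [s [/= <- <-]].
apply: eq_eseriesr => m _.
have -> : [set s : batch S | size s = m] =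
    \big[setU/set0]_(t <- index_enum (m.-tuple 'I_S : finType)) [set tval t].
  rewrite -bigcup_seq; apply/seteqP; split=> [s /= sm|s [t _ /= ->]].
    by exists (Tuple (introT eqP sm)) => //=; exact: mem_index_enum.
  exact: size_tuple.
rewrite ge0_integral_bigsetU//; last 3 first.
- exact: index_enum_uniq.
- by move=> t u _ _ [s [/= -> /val_inj]].
- by move=> x _; rewrite lee_fin.
rewrite mulr_sumr -sumEFin; apply: eq_bigr => t _.
rewrite (eq_integral (cst (F t)%:E)) => [|s]; last by rewrite inE/= => ->.
rewrite integral_cst// [X in (_ * X)%E](batch_law_set1 t) -EFinM; congr _%:E.
by rewrite /batch_pmf size_tuple; ring.
Qed.

Lemma sum_tupleS m (G : seq 'I_S -> R) :
  \sum_(t : m.+1.-tuple 'I_S) G t = \sum_x \sum_(t : m.-tuple 'I_S) G (x :: t).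
Proof.
rewrite pair_big_dep/= (reindex (fun p : 'I_S * m.-tuple 'I_S => [tuple of p.1 :: p.2]))//=.
exists (fun t => (thead t, [tuple of behead t])) => [[x t] _|t _] /=.
  by congr pair; apply/val_inj.
by rewrite [RHS]tuple_eta.
Qed.

Lemma sum_tuple_prod_fun m (g : 'I_S -> R) :
  \sum_(t : m.-tuple 'I_S) (\prod_(x <- t) g x) * \prod_(x <- t) Q x
    = (\sum_x Q x * g x) ^+ m.
Proof.
elim: m => [|m IH].
  rewrite (eq_bigr (fun=> 1)) => [|t _]; last by rewrite tuple0 !big_nil mulr1.
  by rewrite sumr_const card_tuple expn0 expr0.
rewrite (sum_tupleS _ (fun s => (\prod_(x <- s) g x) * \prod_(x <- s) Q x)).
rewrite exprS mulr_suml; apply: eq_bigr => x _; rewrite -IH mulr_sumr.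
by apply: eq_bigr => t _; rewrite !big_cons; ring.
Qed.

(** Induction on the number of draws. Prepending a draw acts on each binomial by Pascal's rule, and
    disjointness of [A] and [B] kills the term where both counts would grow. In the proof [prev]
    lowers an index, with value 0 at index 0. *)
Lemma sum_tuple_bin m k l (A B : pred 'I_S) : (forall x, ~~ (A x && B x)) ->
  \sum_(t : m.-tuple 'I_S) ('C(count A t, k)%:R * 'C(count B t, l)%:R)
      * \prod_(x <- t) Q x
  = 'C(m, k + l)%:R * 'C(k + l, k)%:R * (\sum_(x | A x) Q x) ^+ k
      * (\sum_(x | B x) Q x) ^+ l.
Proof.
move=> AB; set qA := \sum_(x | A x) _; set qB := \sum_(x | B x) _.
pose W m k l := \sum_(t : m.-tuple 'I_S)
  ('C(count A t, k)%:R * 'C(count B t, l)%:R) * \prod_(x <- t) Q x.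
rewrite -/(W m k l).
pose prev (f : nat -> R) k := if k is k'.+1 then f k' else 0.
have bin_prev (b : bool) c j :
    'C(b + c, j)%:R = 'C(c, j)%:R + b%:R * prev (fun i => 'C(c, i)%:R) j :> R.
  case: b; rewrite ?add0n ?mul0r ?addr0// add1n mul1r.
  by case: j => [|j] /=; rewrite ?bin0 ?addr0// binS natrD.
have WS m' k' l' : W m'.+1 k' l' = W m' k' l'
    + qA * prev (fun i => W m' i l') k' + qB * prev (fun i => W m' k' i) l'.
  rewrite /W (sum_tupleS _ (fun s => 'C(count A s, k')%:R * 'C(count B s, l')%:R
      * \prod_(x <- s) Q x)).
  rewrite exchange_big/=.
  have -> : qA * prev (fun i => W m' i l') k' = \sum_(t : m'.-tuple 'I_S)
      qA * (prev (fun i => 'C(count A t, i)%:R) k' * 'C(count B t, l')%:R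
        * \prod_(x <- t) Q x).
    rewrite -mulr_sumr; congr (_ * _); case: (k') => [|j] //=.
    by rewrite big1// => t _; rewrite !mul0r.
  have -> : qB * prev (fun i => W m' k' i) l' = \sum_(t : m'.-tuple 'I_S)
      qB * ('C(count A t, k')%:R * prev (fun i => 'C(count B t, i)%:R) l'
        * \prod_(x <- t) Q x).
    rewrite -mulr_sumr; congr (_ * _); case: (l') => [|j] //=.
    by rewrite big1// => t _; rewrite mulr0 mul0r.
  rewrite -!big_split/=; apply: eq_bigr => t _.
  transitivity (\sum_x (Q x * ('C(count A t, k')%:R * 'C(count B t, l')%:R
          * \prod_(y <- t) Q y)
      + (Q x * (A x)%:R) * (prev (fun i => 'C(count A t, i)%:R) k' * 'C(count B t, l')%:R
        * \prod_(y <- t) Q y)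
      + (Q x * (B x)%:R) * ('C(count A t, k')%:R * prev (fun i => 'C(count B t, i)%:R) l'
        * \prod_(y <- t) Q y))).
    apply: eq_bigr => x _; rewrite !bin_prev big_cons.
    have : (A x)%:R * (B x)%:R = 0 :> R.
      by rewrite -natrM mulnb (negPf (AB x)).
    move: (A x)%:R (B x)%:R => a b ab.
    set pk := prev _ _; set pl := prev _ _.
    by transitivity (Q x * (\prod_(y <- t) Q y) * ('C(count A t, k')%:R * 'C(count B t, l')%:R
      + a * pk * 'C(count B t, l')%:R + 'C(count A t, k')%:R * b * pl + a * b * pk * pl));
     [ring|rewrite ab; ring].
  rewrite !big_split/= -!mulr_suml prob_of_sum1 mul1r.
  have sumQ (D : pred 'I_S) : \sum_(x | D x) Q x = \sum_x Q x * (D x)%:R.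
    by rewrite big_mkcond/=; apply: eq_bigr => x _; case: (D x); rewrite ?mulr1 ?mulr0.
  by rewrite /qA /qB !sumQ.
elim: m k l => [|m IH] k l.
  rewrite /W (eq_bigr (fun=> (k == 0)%:R * (l == 0)%:R)) => [|t _]; last first.
    by rewrite tuple0 big_nil mulr1 !bin0n.
  rewrite sumr_const card_tuple expn0 mulr1n bin0n addn_eq0.
  by case: k l => [|k] [|l]; rewrite ?bin0 ?expr0 ?mulr1 ?mul0r ?mulr0.
rewrite WS; case: k l => [|k] [|l] /=; rewrite !IH ?mulr0 ?addr0 ?addn0 ?add0n.
- by rewrite !bin0.
- by rewrite !bin0 binS natrD exprS; ring.
- by rewrite !binn binS natrD exprS; ring.
- by rewrite addSn addnS !binS !natrD !exprS; ring.
Qed.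

(** Integrability is bundled with the value, since linearity of the integral needs it for functions
    of arbitrary sign. *)
Definition batch_mean F (v : R) := mu.-integrable setT (EFin \o F) /\
  (\int[mu]_s (F s)%:E)%E = v%:E.

Lemma batch_mean_ge0 F v : (forall s, 0 <= F s) ->
  (\int[mu]_s (F s)%:E)%E = v%:E -> batch_mean F v.
Proof.
move=> F0 Fv; split=> //; apply/integrableP; split; first exact: measurable_batch.
rewrite (eq_integral (fun s => (F s)%:E)) => [|s _]; first by rewrite Fv ltry.
by rewrite /= ger0_norm.
Qed.

Lemma batch_meanD F G u v : batch_mean F u -> batch_mean G v ->
  batch_mean (fun s => F s + G s) (u + v).
Proof.
move=> [iF EF] [iG EG]; split.
  exact: (@integrableD _ _ _ mu _ measurableT _ _ iF iG).
by under eq_integral do rewrite EFinD; rewrite integralD// EF EG.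
Qed.

Lemma batch_meanZ a F v : batch_mean F v -> batch_mean (fun s => a * F s) (a * v).
Proof.
move=> [iF EF]; split; first exact: (@integrableZl _ _ _ mu _ measurableT a _ iF).
by under eq_integral do rewrite EFinM; rewrite integralZl// EF.
Qed.

Lemma eq_batch_mean F G u : (forall s, G s = F s) -> batch_mean F u -> batch_mean G u.
Proof. by move=> /funext ->. Qed.

Lemma batch_mean_uniq F u v : batch_mean F u -> batch_mean F v -> u = v.
Proof. by move=> [_ Fu] [_]; rewrite Fu => -[]. Qed.

Lemma batch_mean_cst c : batch_mean (fun=> c) c.
Proof.
suff H1 : batch_mean (fun=> 1) 1.
  by have := batch_meanZ c H1; rewrite mulr1.
apply: batch_mean_ge0 => //.
by rewrite (integral_cst mu measurableT 1) mul1e; exact: probability_setT.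
Qed.

Lemma batch_mean_sum (I : Type) (r : seq I) (F : I -> batch S -> R) (v : I -> R) :
  (forall i, batch_mean (F i) (v i)) ->
  batch_mean (fun s => \sum_(i <- r) F i s) (\sum_(i <- r) v i).
Proof.
move=> Fv; elim: r => [|i r IH].
  by rewrite big_nil; apply: eq_batch_mean (batch_mean_cst 0) => s; rewrite big_nil.
rewrite big_cons; apply: eq_batch_mean (batch_meanD (Fv i) IH) => s.
by rewrite big_cons.
Qed.

(** Poissonization makes the counts independent: averaging ['C(m, k + l)] over the size gives
    [n ^+ (k + l) / (k + l)!], which the multinomial factor ['C(k + l, k)] splits into a product.
    Sets of symbols allow [pred0], and so the moments of a single count. *)
Lemma batch_mean_count_bin k l (A B : pred 'I_S) : (forall x, ~~ (A x && B x)) ->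
  batch_mean (fun s => 'C(count A s, k)%:R * 'C(count B s, l)%:R)
    ((n%:R * \sum_(x | A x) Q x) ^+ k / k`!%:R
     * ((n%:R * \sum_(x | B x) Q x) ^+ l / l`!%:R)).
Proof.
move=> AB; apply: batch_mean_ge0 => [s|]; first by rewrite mulr_ge0.
rewrite integral_batch => [|s]; last by rewrite mulr_ge0.
set qA := \sum_(x | A x) _; set qB := \sum_(x | B x) _.
rewrite (eq_eseriesr (g := fun m => (('C(k + l, k)%:R * qA ^+ k * qB ^+ l)%:E *
     (poisson_pmf n%:R m * 'C(m, k + l)%:R)%:E)%E)); last first.
  by move=> m _; rewrite sum_tuple_bin// -EFinM; congr _%:E; rewrite -/qA -/qB; ring.
rewrite nneseriesZl; last by move=> m _; rewrite lee_fin mulr_ge0 ?poisson_pmf_ge0.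
rewrite sum_poisson_pmf_bin// -EFinM; congr _%:E.
have klE : ('C(k + l, k) * (k`! * l`!) = (k + l)`!)%N.
  by rewrite -[in l`!](addKn k l) bin_fact// leq_addr.
rewrite -klE !natrM !exprMn exprD; field.
by rewrite !pnatr_eq0 -!lt0n !fact_gt0 bin_gt0 leq_addr.
Qed.

Lemma batch_mean_bin2 (i j : 'I_S) k l : i != j ->
  batch_mean (fun s => 'C(count_mem i s, k)%:R * 'C(count_mem j s, l)%:R)
    ((n%:R * Q i) ^+ k / k`!%:R * ((n%:R * Q j) ^+ l / l`!%:R)).
Proof.
move=> ij; have := @batch_mean_count_bin k l (pred1 i) (pred1 j).
rewrite !big_pred1_eq; apply => x /=.
by apply: contra ij => /andP[/eqP <- /eqP <-].
Qed.

Lemma batch_mean_bin (i : 'I_S) k :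
  batch_mean (fun s => 'C(count_mem i s, k)%:R) ((n%:R * Q i) ^+ k / k`!%:R).
Proof.
have := @batch_mean_count_bin k 0 (pred1 i) pred0.
rewrite big_pred1_eq expr0 fact0 divr1 mulr1 => H.
by apply: eq_batch_mean (H _) => [s|x]; rewrite ?bin0 ?mulr1//= andbF.
Qed.

(** The relation [x * 'C(x, k) = k.+1 * 'C(x, k.+1) + k * 'C(x, k)] lets binomials absorb a factor
    [x]. The list may repeat an index, so no like terms are collected. *)
Lemma horner_bin_sum (p : {poly R}) : exists u : seq (R * nat),
  forall x : nat, p.[x%:R] = \sum_(a <- u) a.1 * 'C(x, a.2)%:R.
Proof.
elim/poly_ind: p => [|p c [u pu]].
  by exists [::] => x; rewrite big_nil horner0.
exists ((c, 0%N) :: [seq (a.1 * a.2.+1%:R, a.2.+1) | a <- u]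
      ++ [seq (a.1 * a.2%:R, a.2) | a <- u]) => x.
rewrite hornerMXaddC pu big_cons big_cat !big_map /= bin0 mulr1.
rewrite [LHS]addrC; congr (_ + _); rewrite mulr_suml -big_split/=; apply: eq_bigr => -[a k] _ /=.
have xE : (x * 'C(x, k) = k.+1 * 'C(x, k.+1) + k * 'C(x, k))%N.
  case: x => [|x]; first by rewrite mul0n !bin0n muln0; case: k => // k; rewrite muln0.
  rewrite -mul_bin_diag/=.
  have [kx|xk] := leqP k x.+1; last by rewrite !bin_small ?muln0// (ltn_trans _ xk).
  by rewrite mul_bin_down -mulnDl subnK.
have -> : a * 'C(x, k)%:R * x%:R = a * (x * 'C(x, k))%:R by rewrite natrM; ring.
by rewrite xE natrD !natrM; ring.
Qed.

Definition poly_mean (i : 'I_S) (p : {poly R}) : R :=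
  fine (\int[mu]_s (p.[(count_mem i s)%:R])%:E)%E.

Lemma batch_mean_poly_ex i p (u : seq (R * nat)) :
  (forall x : nat, p.[x%:R] = \sum_(a <- u) a.1 * 'C(x, a.2)%:R) ->
  batch_mean (fun s => p.[(count_mem i s)%:R])
    (\sum_(a <- u) a.1 * ((n%:R * Q i) ^+ a.2 / a.2`!%:R)).
Proof.
move=> pu; apply: (eq_batch_mean (F := fun s =>
  \sum_(a <- u) a.1 * 'C(count_mem i s, a.2)%:R)) => [s|]; first exact: pu.
by apply: batch_mean_sum => a; apply: batch_meanZ; exact: batch_mean_bin.
Qed.

Lemma poly_meanE i p : batch_mean (fun s => p.[(count_mem i s)%:R]) (poly_mean i p).
Proof.
have [u pu] := horner_bin_sum p.
have H := batch_mean_poly_ex i pu.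
by rewrite /poly_mean (proj2 H).
Qed.

Lemma poly_mean_eq i p v :
  batch_mean (fun s => p.[(count_mem i s)%:R]) v -> poly_mean i p = v.
Proof. by move=> H; apply: batch_mean_uniq (poly_meanE i p) H. Qed.

Lemma eq_poly_mean i (p q : {poly R}) : (forall x : nat, p.[x%:R] = q.[x%:R]) ->
  poly_mean i p = poly_mean i q.
Proof.
by move=> pq; apply: poly_mean_eq; apply: eq_batch_mean (poly_meanE i q) => s.
Qed.

Lemma poly_meanD i p q : poly_mean i (p + q) = poly_mean i p + poly_mean i q.
Proof.
apply: poly_mean_eq; apply: eq_batch_mean (batch_meanD (poly_meanE i p) (poly_meanE i q)).
by move=> s; rewrite hornerD.
Qed.

Lemma poly_meanZ i a p : poly_mean i (a *: p) = a * poly_mean i p.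
Proof.
apply: poly_mean_eq; apply: eq_batch_mean (batch_meanZ a (poly_meanE i p)).
by move=> s; rewrite hornerZ.
Qed.

Lemma poly_mean_sum i (I : Type) (r : seq I) (p : I -> {poly R}) :
  poly_mean i (\sum_(k <- r) p k) = \sum_(k <- r) poly_mean i (p k).
Proof.
apply: poly_mean_eq; apply: eq_batch_mean (batch_mean_sum r (fun k => poly_meanE i (p k))).
by move=> s; rewrite horner_sum.
Qed.

Lemma poly_mean1 i : poly_mean i 1 = 1.
Proof.
apply: poly_mean_eq; apply: eq_batch_mean (batch_mean_cst 1).
by move=> s; rewrite hornerC.
Qed.

(* Mecke's (or Stein's) identity, which characterises the Poisson law. *)
Lemma poly_mean_mecke i p :
  poly_mean i ('X * (p \Po ('X - 1))) = n%:R * Q i * poly_mean i p.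
Proof.
have [u pu] := horner_bin_sum p.
rewrite (poly_mean_eq (batch_mean_poly_ex i pu)).
pose u' := [seq (a.1 * a.2.+1%:R, a.2.+1) | a <- u].
have pu' (x : nat) :
    ('X * (p \Po ('X - 1))).[x%:R] = \sum_(a <- u') a.1 * 'C(x, a.2)%:R.
  rewrite hornerM hornerX horner_comp hornerXsubC big_map/=.
  case: x => [|x]; first by rewrite mul0r big1// => a _; rewrite bin0n mulr0.
  rewrite -natr1 addrK pu natr1 mulr_sumr; apply: eq_bigr => a _.
  by rewrite mulrCA -natrM -[x in 'C(x, _)]/(x.+1.-1) mul_bin_diag natrM mulrA.
rewrite (poly_mean_eq (batch_mean_poly_ex i pu')) big_map mulr_sumr.
apply: eq_bigr => -[a k] _ /=; rewrite factS natrM exprS; field.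
by rewrite ?nat1r !pnatr_eq0 -!lt0n fact_gt0.
Qed.

Lemma batch_mean_indep (i j : 'I_S) p q : i != j ->
  batch_mean (fun s => p.[(count_mem i s)%:R] * q.[(count_mem j s)%:R])
    (poly_mean i p * poly_mean j q).
Proof.
move=> ij; have [u pu] := horner_bin_sum p; have [v qv] := horner_bin_sum q.
rewrite (poly_mean_eq (batch_mean_poly_ex i pu)) (poly_mean_eq (batch_mean_poly_ex j qv)).
rewrite mulr_suml.
apply: (eq_batch_mean (F := fun s => \sum_(a <- u) \sum_(b <- v)
   a.1 * (b.1 * ('C(count_mem i s, a.2)%:R * 'C(count_mem j s, b.2)%:R)))).
  move=> s; rewrite pu qv mulr_suml; apply: eq_bigr => a _.
  by rewrite mulr_sumr; apply: eq_bigr => b _; ring.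
apply: batch_mean_sum => a; rewrite mulr_sumr.
apply: batch_mean_sum => b.
have := batch_meanZ a.1 (batch_meanZ b.1 (batch_mean_bin2 a.2 b.2 ij)).
by congr batch_mean; ring.
Qed.

Lemma batch_mean_sqr_sum (p : 'I_S -> {poly R}) (d : R) :
  batch_mean (fun s => (\sum_i (p i).[(count_mem i s)%:R] - d) ^+ 2)
    ((\sum_i poly_mean i (p i) - d) ^+ 2
     + \sum_i (poly_mean i (p i ^+ 2) - poly_mean i (p i) ^+ 2)).
Proof.
pose v i j := if i == j then poly_mean i (p i ^+ 2)
  else poly_mean i (p i) * poly_mean j (p j).
have -> : (\sum_i poly_mean i (p i) - d) ^+ 2
     + \sum_i (poly_mean i (p i ^+ 2) - poly_mean i (p i) ^+ 2)
  = \sum_i \sum_j v i j + (- (2 * d) * \sum_i poly_mean i (p i) + d ^+ 2).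
  have -> : \sum_i \sum_j v i j = (\sum_i poly_mean i (p i)) ^+ 2
     + \sum_i (poly_mean i (p i ^+ 2) - poly_mean i (p i) ^+ 2).
    rewrite [X in X + _]expr2 mulr_suml -big_split/=; apply: eq_bigr => i _.
    rewrite (bigD1 i)//= {1}/v eqxx mulr_sumr [in RHS](bigD1 i)//= expr2.
    rewrite (eq_bigr (fun j => poly_mean i (p i) * poly_mean j (p j))).
      by ring.
    by move=> j ji; rewrite /v eq_sym (negPf ji).
  by ring.
apply: (eq_batch_mean (F := fun s =>
   \sum_i \sum_j (p i).[(count_mem i s)%:R] * (p j).[(count_mem j s)%:R]
   + (- (2 * d) * \sum_i (p i).[(count_mem i s)%:R] + d ^+ 2))).
  move=> s; set t := \sum_i _; have -> : \sum_i \sum_j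
     (p i).[(count_mem i s)%:R] * (p j).[(count_mem j s)%:R] = t * t.
    by rewrite [RHS]mulr_suml; apply: eq_bigr => i _; rewrite mulr_sumr.
  by ring.
apply: batch_meanD; last first.
  apply: batch_meanD; last exact: batch_mean_cst.
  by apply: batch_meanZ; apply: batch_mean_sum => i; exact: poly_meanE.
apply: batch_mean_sum => i; apply: batch_mean_sum => j.
rewrite /v; case: eqVneq => [<-|ij]; last exact: batch_mean_indep.
by apply: eq_batch_mean (poly_meanE i _) => s; rewrite expr2 hornerM.
Qed.

End batch_expectation.

(** * Chernoff bounds and Charlier polynomials *)

Section chernoff.
Context {R : realType} {S : nat} (Q : probvec R S) (n : nat).
Hypothesis n_gt0 : (0 < n)%N.
Local Notation mu := (batch_law Q n).

(** The event carries the factor [t], so that the sign of [t] selects the upper or the lower tail.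
    The exponential moment is a product over the draws, which the Poisson size turns into an
    exponential. *)
Lemma batch_chernoff (i : 'I_S) (t y : R) :
  (mu [set s | (t * y <= t * (count_mem i s)%:R)%R]
    <= (expR (n%:R * Q i * (expR t - 1) - t * y)%R)%:E)%E.
Proof.
set A := [set s | _].
pose g (x : 'I_S) := expR (t * (x == i)%:R).
have gE (s : batch S) : \prod_(x <- s) g x = expR (t * (count_mem i s)%:R).
  elim: s => [|x s IH]; first by rewrite big_nil mulr0 expR0.
  by rewrite big_cons IH -expRD -mulrDr -natrD.
have Qg : \sum_x Q x * g x = 1 + Q i * (expR t - 1).
  have s1 : Q i + \sum_(x | x != i) Q x = 1 by rewrite -(prob_of_sum1 Q) [RHS](bigD1 i).
  rewrite (bigD1 i)//= /g eqxx mulr1 (eq_bigr Q) => [|x xi].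
    by rewrite -[in X in _ = X + _]s1; ring.
  by rewrite (negPf xi) mulr0 expR0 mulr1.
have Qi : 0 <= Q i <= 1.
  rewrite prob_of_ge0/= -(prob_of_sum1 Q) (bigD1 i)//= lerDl.
  by apply: sumr_ge0 => x _; exact: prob_of_ge0.
have z0 : 0 < 1 + Q i * (expR t - 1) by have := expR_gt0 t; nra.
have -> : (expR (n%:R * Q i * (expR t - 1) - t * y))%:E
    = (\int[mu]_s (expR (- (t * y)) * \prod_(x <- s) g x)%:E)%E.
  rewrite integral_batch// => [|s]; last first.
    by rewrite mulr_ge0 ?expR_ge0// prodr_ge0// => x _; exact: expR_ge0.
  rewrite (eq_eseriesr (g := fun m => ((expR (- (t * y)))%:E *
      (poisson_pmf n%:R m * (1 + Q i * (expR t - 1)) ^+ m)%:E)%E)); last first.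
    move=> m _; rewrite -EFinM; congr _%:E.
    rewrite -Qg -sum_tuple_prod_fun [RHS]mulrCA; congr (_ * _); rewrite mulr_sumr.
    by apply: eq_bigr => s _; rewrite mulrA.
  rewrite nneseriesZl; last first.
    by move=> m _; rewrite lee_fin mulr_ge0 ?poisson_pmf_ge0// exprn_ge0// ltW.
  rewrite sum_poisson_pmf_exp ?ltr0n// -EFinM -expRD; congr (expR _)%:E; ring.
have -> : mu A = (\int[mu]_s (\1_A s)%:E)%E by rewrite integral_indic// setIT.
apply: ge0_le_integral => //= s _; rewrite lee_fin gE -expRD.
rewrite indicE; case: (boolP (s \in A)) => [|_]; last exact: expR_ge0.
rewrite inE /A /= => H; rewrite mulr1n -[leLHS](@expR0 R) ler_expR.
by rewrite addrC subr_ge0.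
Qed.

Lemma expR_le_quad (t : R) : 0 <= t <= 1 / 4 -> expR t <= 1 + t + t ^+ 2.
Proof.
move=> /andP[t0 t1].
have h := expR_ge1Dx (- (t / 2)).
have e : expR t * expR (- (t / 2)) ^+ 2 = 1.
  by rewrite -expRM_natl -expRD -[RHS]expR0; congr expR; field.
have h2 : (1 - t / 2) ^+ 2 <= expR (- (t / 2)) ^+ 2.
  by rewrite lerXn2r ?nnegrE ?expR_ge0//; lra.
have : (1 - t / 2) ^+ 2 * expR t <= (1 - t / 2) ^+ 2 * (1 + t + t ^+ 2).
  apply: (@le_trans _ _ 1).
    by rewrite -[leRHS]e [leRHS]mulrC ler_wpM2r ?expR_ge0.
  have -> : (1 - t / 2) ^+ 2 * (1 + t + t ^+ 2)
     = 1 + t ^+ 2 * (1 - 3 * t + t ^+ 2) / 4 by field.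
  by rewrite lerDl divr_ge0// mulr_ge0 ?sqr_ge0//; nra.
by rewrite ler_pM2l// exprn_gt0//; lra.
Qed.

Lemma expRN_le_quad (t : R) : 0 <= t -> expR (- t) <= 1 - t + t ^+ 2.
Proof.
move=> t0; rewrite expRN -[leLHS]mul1r ler_pdivrMr ?expR_gt0//.
apply: (@le_trans _ _ ((1 - t + t ^+ 2) * (1 + t))); first by nra.
by rewrite ler_wpM2l ?expR_ge1Dx//; nra.
Qed.

(** [m] only bounds the mean from above, so the bound covers symbols of tiny probability. The choice
    [t = u / (2 * m)] minimises [m * t ^+ 2 - t * u], and [u <= m / 2] keeps it in the range of
    [expR_le_quad]. *)
Lemma batch_tail_ge (i : 'I_S) (m u y : R) : 0 < m -> 0 <= u <= m / 2 ->
  n%:R * Q i <= m -> n%:R * Q i + u <= y ->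
  (mu [set s | (y <= (count_mem i s)%:R)%R] <= (expR (- (u ^+ 2 / (4 * m))))%:E)%E.
Proof.
move=> m0 /andP[u0 um] lm ly.
have l0 : 0 <= n%:R * Q i by rewrite mulr_ge0 ?prob_of_ge0.
pose t := u / (2 * m).
have t0 : 0 <= t by rewrite divr_ge0// mulr_ge0// ltW.
have t1 : t <= 1 / 4 by rewrite ler_pdivrMr ?mulr_gt0//; lra.
apply: (@le_trans _ _ (mu [set s | (t * y <= t * (count_mem i s)%:R)%R])).
  apply: le_measure; rewrite ?inE//.
  by move=> s /= H; rewrite ler_wpM2l.
apply: (le_trans (batch_chernoff i t y)); rewrite lee_fin ler_expR.
have -> : - (u ^+ 2 / (4 * m)) = m * t ^+ 2 - t * u by rewrite /t; field; rewrite gt_eqF.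
have := expR_le_quad (introT andP (conj t0 t1)).
move: l0 lm ly; set l := _ * Q i; set e := expR t => l0 lm ly He.
have H1 : l * (e - 1) <= l * (t + t ^+ 2) by rewrite ler_wpM2l//; lra.
have H2 : t * (l + u) <= t * y by rewrite ler_wpM2l.
have H3 : l * t ^+ 2 <= m * t ^+ 2 by rewrite ler_wpM2r ?sqr_ge0.
lra.
Qed.

Lemma batch_tail_le (i : 'I_S) (m u y : R) : 0 < m -> 0 <= u <= m ->
  m <= n%:R * Q i -> y + u <= m ->
  (mu [set s | ((count_mem i s)%:R <= y)%R] <= (expR (- (u ^+ 2 / (4 * m))))%:E)%E.
Proof.
move=> m0 /andP[u0 um] lm ly.
pose t := u / (2 * m).
have t0 : 0 <= t by rewrite divr_ge0// mulr_ge0// ltW.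
have t1 : t <= 1 by rewrite ler_pdivrMr ?mulr_gt0//; lra.
apply: (@le_trans _ _ (mu [set s | (- t * y <= - t * (count_mem i s)%:R)%R])).
  apply: le_measure; rewrite ?inE//.
  by move=> s /= H; rewrite !mulNr lerN2 ler_wpM2l.
apply: (le_trans (batch_chernoff i (- t) y)); rewrite lee_fin ler_expR.
have -> : - (u ^+ 2 / (4 * m)) = m * t ^+ 2 - t * u by rewrite /t; field; rewrite gt_eqF.
have := expRN_le_quad t0.
move: lm; set l := _ * Q i; set e := expR _ => lm He.
have l0 : 0 <= l by lra.
have H1 : l * (e - 1) <= l * (- t + t ^+ 2) by rewrite ler_wpM2l//; lra.
have H2 : t * (y + u) <= t * m by rewrite ler_wpM2l.
(* A mean larger than [m] only lowers the exponent, because [t <= 1]. *)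
have H3 : 0 <= (l - m) * (t * (1 - t)).
  by rewrite mulr_ge0 ?subr_ge0// mulr_ge0// subr_ge0.
nra.
Qed.
End chernoff.

(** * Charlier polynomials and their moments *)

Section charlier.
Context {R : realType}.

(** Monic Charlier polynomials: [('X - al) ^+ j] with each power of ['X] replaced by the falling
    factorial. The recursion is in the form to which Mecke's identity applies. *)
Fixpoint charlier (al : R) (j : nat) : {poly R} :=
  if j is j'.+1 then 'X * (charlier al j' \Po ('X - 1)) - al *: charlier al j' else 1.

Lemma charlierS al j x : (charlier al j.+1).[x]
  = x * (charlier al j).[x - 1] - al * (charlier al j).[x].
Proof.
by rewrite /= hornerD hornerN hornerM hornerX horner_comp hornerXsubC hornerZ.
Qed.

(** On falling factorials the forward difference acts as the derivative. At [j = 0] the index [j.-1]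
    is harmless, its factor being 0. *)
Lemma charlier_shift al j x : (charlier al j).[x + 1]
  = (charlier al j).[x] + j%:R * (charlier al j.-1).[x].
Proof.
elim: j x => [|j IH] x; first by rewrite !hornerC mul0r addr0.
rewrite !charlierS addrK [j.+1.-1]/=.
have := IH (x - 1); rewrite subrK IH => E.
case: j IH E => [|j] IH E; first by rewrite !hornerC; ring.
rewrite [j.+1.-1]/= in E *.
have C : (charlier al j.+1).[x] = x * (charlier al j).[x - 1] - al * (charlier al j).[x].
  exact: charlierS.
have {}E : x * (charlier al j.+1).[x]
    = x * ((charlier al j.+1).[x - 1] + j.+1%:R * (charlier al j).[x - 1]).
  by rewrite -E.
have {}C : j.+1%:R * (charlier al j.+1).[x]
    = j.+1%:R * (x * (charlier al j).[x - 1] - al * (charlier al j).[x]).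
  by rewrite -C.
by rewrite -[j.+2%:R]natr1; lra.
Qed.

Section moments.
Context {S : nat} (Q : probvec R S) (n : nat).
Hypothesis n_gt0 : (0 < n)%N.
Variable (i : 'I_S) (al W : R).
Let lam := n%:R * Q i.
Local Notation M := (poly_mean Q n i).
Local Notation h := (charlier al).

(** Mecke's identity trades the factor [x] for [lam] and a shift; the shifted [h l] is
    [h l + l * h l.-1], and the term in [lam * h l] combines with [al]. Each use lowers [j]. *)
Lemma poly_mean_charlierS j l : M (h j.+1 * h l)
  = (lam - al) * M (h j * h l) + lam * l%:R * M (h j * h l.-1).
Proof.
pose p := h j * h l + l%:R *: (h j * h l.-1).
have -> : M (h j.+1 * h l) = M ('X * (p \Po ('X - 1)) + (- al) *: (h j * h l)).
  apply: eq_poly_mean => // x; rewrite hornerM charlierS hornerD !hornerM !hornerZ.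
  rewrite hornerX horner_comp hornerXsubC /p hornerD !(hornerZ, hornerM).
  by have := charlier_shift al l (x%:R - 1); rewrite subrK => ->; ring.
rewrite poly_meanD// poly_meanZ// poly_mean_mecke// /p poly_meanD// poly_meanZ// -/lam.
ring.
Qed.

Lemma poly_mean_charlier j : M (h j) = (lam - al) ^+ j.
Proof.
elim: j => [|j IH]; first by rewrite /= poly_mean1.
have := poly_mean_charlierS j 0; rewrite /= !mulr1 mulr0 mul0r addr0 => ->.
by rewrite IH exprS.
Qed.

Hypothesis W_ge0 : 0 <= W.
Hypothesis lam_al : `|lam - al| <= W.

(** Each step of the recursion has two terms. One gains [|lam - al| <= W]; the other loses an index
    of [l], but its factor [lam * l] is at most [W ^+ 2]. A step thus costs [2 * W]. *)
Lemma norm_poly_mean_charlierM K j l : lam * K%:R <= W ^+ 2 -> (l <= K)%N ->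
  `|M (h j * h l)| <= 2 ^+ j * W ^+ (j + l).
Proof.
move=> lamK; have lam0 : 0 <= lam by rewrite mulr_ge0 ?prob_of_ge0.
elim: j l => [|j IH] l lK.
  rewrite /= mul1r poly_mean_charlier normrX expr0 mul1r add0n.
  by rewrite lerXn2r ?nnegrE.
rewrite poly_mean_charlierS (le_trans (ler_normD _ _))// normrM.
rewrite [`|lam * _ * _|]normrM [`|lam * _|]normrM.
rewrite (ger0_norm lam0) (ger0_norm (ler0n _ l)).
have h1 := IH l lK.
have h1' : `|lam - al| * `|M (h j * h l)| <= W * (2 ^+ j * W ^+ (j + l)).
  by rewrite ler_pM.
have h2 : lam * l%:R * `|M (h j * h l.-1)| <= W * (2 ^+ j * W ^+ (j + l)).
  case: l lK {h1 h1'} => [|l] lK; first by rewrite mulr0 mul0r !mulr_ge0 ?exprn_ge0.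
  have ll : lam * l.+1%:R <= W ^+ 2.
    by apply: le_trans lamK; rewrite ler_wpM2l// ler_nat.
  apply: (@le_trans _ _ (W ^+ 2 * (2 ^+ j * W ^+ (j + l)))).
    by apply: ler_pM => //; [exact: mulr_ge0|exact: (IH l (ltnW lK))].
  by rewrite addnS [W ^+ (j + l).+1]exprS le_eqVlt; apply/orP; left; apply/eqP; ring.
apply: (le_trans (lerD h1' h2)).
by rewrite addSn !exprS le_eqVlt; apply/orP; left; apply/eqP; ring.
Qed.

(* [Y] is the unbiased estimator of [G.[(lam - al) / W]]. *)
Lemma poly_mean_charlier_comb K (G : {poly R}) (B : R) :
  0 < W -> lam * K%:R <= W ^+ 2 -> \sum_(j < K.+1) `|G`_j| <= B ->
  let Y := \sum_(j < K.+1) (G`_j / W ^+ j) *: h j in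
  M Y = \sum_(j < K.+1) G`_j * ((lam - al) / W) ^+ j /\
  M (Y ^+ 2) <= 2 ^+ K * B ^+ 2.
Proof.
move=> W0 lamK GB Y; split.
  rewrite /Y poly_mean_sum//; apply: eq_bigr => j _.
  by rewrite poly_meanZ// poly_mean_charlier expr_div_n; ring.
have -> : Y ^+ 2 = \sum_(j < K.+1) \sum_(l < K.+1)
    (G`_j / W ^+ j * (G`_l / W ^+ l)) *: (h j * h l).
  rewrite expr2 /Y mulr_suml; apply: eq_bigr => j _.
  rewrite mulr_sumr; apply: eq_bigr => l _.
  by rewrite -scalerAl -scalerAr scalerA.
rewrite poly_mean_sum//.
apply: (@le_trans _ _ (2 ^+ K * (\sum_(j < K.+1) `|G`_j|) ^+ 2)); last first.
  rewrite ler_wpM2l ?exprn_ge0// lerXn2r ?nnegrE ?sumr_ge0//.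
  by apply: le_trans GB; exact: sumr_ge0.
rewrite [X in _ * X]expr2 mulr_suml mulr_sumr; apply: ler_sum => j _.
rewrite poly_mean_sum// !mulr_sumr; apply: ler_sum => l _.
rewrite poly_meanZ// (le_trans (ler_norm _))// !normrM !normfV.
have Wj k : `|W ^+ k| = W ^+ k by rewrite ger0_norm// exprn_ge0.
rewrite !Wj.
have := @norm_poly_mean_charlierM K j l lamK (leq_ord l).
have W1 k : 0 < W ^+ k by rewrite exprn_gt0.
have G1 := normr_ge0 (G`_j); have G2 := normr_ge0 (G`_l).
move=> Mb.
apply: (@le_trans _ _ (`|G`_j| / W ^+ j * (`|G`_l| / W ^+ l) * (2 ^+ j * W ^+ (j + l)))).
  by rewrite ler_wpM2l// !mulr_ge0// invr_ge0 ltW.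
have -> : `|G`_j| / W ^+ j * (`|G`_l| / W ^+ l) * (2 ^+ j * W ^+ (j + l))
    = 2 ^+ j * (`|G`_j| * `|G`_l|).
  by rewrite exprD; field; rewrite !gt_eqF.
by rewrite ler_wpM2r ?mulr_ge0// ler_weXn2l ?leq_ord// ler1n.
Qed.
End moments.

(** Replacing powers by falling factorials is a linear map [T], which turns multiplication by ['X]
    into the shift of the Charlier recursion; it therefore sends powers of the affine variable to
    rescaled Charlier polynomials. The index [N] of [T] is a number of coefficients and grows by one
    with each factor ['X]. *)
Lemma D_tilde_charlier (eps : R) (n K : nat) (c1 p m w x : R) (G : {poly R}) :
  (0 < n)%N -> w != 0 -> (size G <= K.+1)%N ->
  D_poly eps n K c1 p = G \Po (w^-1 *: ('X - m%:P)) ->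
  D_tilde eps n K c1 p (x / n%:R)
    = \sum_(j < K.+1) G`_j / (n%:R * w) ^+ j * (charlier (n%:R * m) j).[x].
Proof.
move=> n0 w0 sG DE; rewrite /D_tilde DE.
have nR : n%:R != 0 :> R by rewrite pnatr_eq0 -lt0n.
pose ff j (y : R) : R := \prod_(k < j) (y / n%:R - k%:R / n%:R).
pose T N (q : {poly R}) y := \sum_(j < N) q`_j * ff j y.
have ffS j y : ff j.+1 y = y / n%:R * ff j (y - 1).
  rewrite /ff big_ord_recl mul0r subr0; congr (_ * _); apply: eq_bigr => k _.
  by rewrite /= /bump/= add1n -natr1; field.
have TX N (q : {poly R}) y : T N.+1 ('X * q) y = y / n%:R * T N q (y - 1).
  rewrite /T big_ord_recl coefXM/= mul0r add0r mulr_sumr; apply: eq_bigr => j _.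
  by rewrite coefXM/= ffS; ring.
have Twiden N N' (q : {poly R}) y : (size q <= N)%N -> (N <= N')%N -> T N' q y = T N q y.
  move=> sq NN'; rewrite /T -(subnKC NN') big_split_ord/= [X in _ + X]big1 ?addr0//.
  by move=> k _; rewrite nth_default ?mul0r// (leq_trans sq)// leq_addr.
pose a : {poly R} := w^-1 *: ('X - m%:P).
have sa j : (size (a ^+ j) <= j.+1)%N.
  rewrite (leq_trans (size_poly_exp_leq _ _))// ltnS.
  have : (size a <= 2)%N by rewrite (leq_trans (size_scale_leq _ _))// size_XsubC.
  by case: (size a) => [|[|[|//]]] _; rewrite ?mul0n ?mul1n.
have Ta N j y : (j < N)%N ->
    T N (a ^+ j) y = ((n%:R * w) ^+ j)^-1 * (charlier (n%:R * m) j).[y].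
  elim: j N y => [|j IH] N y jN.
    rewrite expr0 invr1 hornerC mulr1 (Twiden 1%N N) ?size_poly1//.
    by rewrite /T big_ord_recl big_ord0 coefC /ff big_ord0 mulr1 addr0.
  case: N jN => // N jN; rewrite exprS {1}/a -scalerAl mulrBl scalerBr.
  have -> : T N.+1 (w^-1 *: ('X * a ^+ j) - w^-1 *: (m%:P * a ^+ j)) y
     = w^-1 * (T N.+1 ('X * a ^+ j) y - m * T N.+1 (a ^+ j) y).
    rewrite /T mulr_sumr -sumrB mulr_sumr; apply: eq_bigr => k _.
    by rewrite coefB !coefZ coefCM; ring.
  rewrite TX !IH ?(ltnW jN)// charlierS exprS; field.
  by rewrite nR w0 ?expf_neq0 ?mulf_neq0.
rewrite -/(T K.+1 (G \Po a) x).
have -> : T K.+1 (G \Po a) x = \sum_(j < K.+1) G`_j * T K.+1 (a ^+ j) x.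
  rewrite comp_polyE (_ : \sum_(j < size G) G`_j *: a ^+ j
      = \sum_(j < K.+1) G`_j *: a ^+ j); last first.
    rewrite -(subnKC sG) big_split_ord/= [X in _ + X]big1 ?addr0// => k _.
    by rewrite nth_default ?scale0r// leq_addr.
  rewrite /T; under eq_bigr do rewrite coef_sum mulr_suml.
  rewrite exchange_big/=; apply: eq_bigr => j _; rewrite mulr_sumr.
  by apply: eq_bigr => k _; rewrite coefZ mulrA.
by apply: eq_bigr => j _; rewrite Ta// mulrA.
Qed.
End charlier.

(** * One symbol *)

Section symbol.
Context {R : realType} (eps : R) (n : nat).
Hypothesis n_gt1 : (1 < n)%N.
Local Notation E := (expR eps).
Definition log_rate : R := ln n%:R / n%:R.
Local Notation L := log_rate.

(* With center [m] and radius [w] such that [w ^+ 2 = c1 * L * m], both cases of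
   the definition of [U c1 c1 p] become [m - w, m + w]. *)
Definition U_center (c1 p : R) : R := Num.max (p / E) (c1 * L).
Definition U_radius (c1 p : R) : R := Num.sqrt (c1 * L * U_center c1 p).

Lemma ln_nat_gt0 : 0 < ln n%:R :> R.
Proof. by rewrite ln_gt0// ltr1n. Qed.

Let n_gt0 : 0 < n%:R :> R. Proof. by rewrite ltr0n ltnW. Qed.
Let L_gt0 : 0 < L. Proof. by rewrite divr_gt0// ln_nat_gt0. Qed.

Variables (c1 p : R).
Hypothesis c1_gt0 : 0 < c1.
Hypothesis p_ge0 : 0 <= p.
Local Notation m := (U_center c1 p).
Local Notation w := (U_radius c1 p).

Lemma small_prob : (p <= c1 * E * ln n%:R / n%:R) = (p / E <= c1 * L).
Proof.
by rewrite ler_pdivrMr ?expR_gt0// /log_rate; congr (_ <= _); ring.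
Qed.

Let c1L_gt0 : 0 < c1 * L. Proof. exact: mulr_gt0. Qed.
Let m_gt0 : 0 < m. Proof. by rewrite lt_max c1L_gt0 orbT. Qed.

Lemma U_radius_gt0 : 0 < w.
Proof. by rewrite sqrtr_gt0 mulr_gt0. Qed.

Lemma U_radius_sqr : w ^+ 2 = c1 * L * m.
Proof. by rewrite sqr_sqrtr// mulr_ge0// ltW. Qed.

Lemma U_radius_le_center : w <= m.
Proof.
rewrite -ler_sqr ?nnegrE ?(ltW m_gt0) ?sqrtr_ge0// U_radius_sqr expr2.
by rewrite ler_wpM2r ?(ltW m_gt0)// le_max lexx orbT.
Qed.

Lemma UE : U eps n c1 c1 p = `[m - w, m + w].
Proof.
rewrite /U /U_left /U_right small_prob /w /m.
case: leP => [pc|/ltW cp].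
  rewrite -expr2 sqrtr_sqr (ger0_norm (ltW c1L_gt0)) subrr /log_rate.
  by congr (Interval _ (BRight _)); ring.
have -> : c1 * expR (- eps) * p * ln n%:R / n%:R = c1 * L * (p / E).
  by rewrite expRN /log_rate; ring.
by rewrite expRN mulrC.
Qed.

(** [G] is the best approximation in the variable [(q - m) / w], where the kink sits at [y0] in
    [-1, 0]. The point of the bias bound is its factor [p], which sums to 1 over the symbols. *)
Lemma D_poly_spec (K : nat) : (0 < K)%N -> exists G : {poly R}, exists err : R,
  [/\ (size G <= K.+1)%N,
      D_poly eps n K c1 p = G \Po (w^-1 *: ('X - m%:P)),
      \sum_(j < K.+1) `|G`_j| <= 2 * E * w * expR (2 * K%:R),
      0 <= err /\ err ^+ 2 <= 128 * c1 * E * p * L / K%:R ^+ 2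
    & forall q, m - w <= q <= m + w ->
        `|Num.max (p - E * q) 0 - (D_poly eps n K c1 p).[q]| <= err].
Proof.
move=> K0; have w0 := U_radius_gt0; have E0 := expR_gt0 eps.
have wn0 : w != 0 by rewrite gt_eqF.
have En0 : E != 0 by rewrite gt_eqF.
have KR : 0 < K%:R :> R by rewrite ltr0n.
set D := D_poly eps n K c1 p.
pose f x := Num.max (p - E * x) 0.
have am : p / E <= m by rewrite le_max lexx.
have a0 : 0 <= p / E by rewrite divr_ge0// ltW.
have fB q : m - w <= q <= m + w -> `|f q| <= E * w.
  move=> /andP[q1 q2]; rewrite /f ger0_norm ?le_max ?lexx ?orbT// ge_max.
  rewrite (mulr_ge0 (ltW E0) (ltW w0)) andbT.
  have -> : p - E * q = E * (p / E - q) by field.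
  by rewrite ler_pM2l//; lra.
have [sD HD] : best_uniform_approx [set` U eps n c1 c1 p] f K D.
  have ex : exists D, best_uniform_approx [set` U eps n c1 c1 p] f K D.
    by rewrite UE; apply: best_uniform_approx_exists fB.
  exact: (xgetPex 0 ex).
rewrite UE in HD.
have best (D' : {poly R}) e : (size D' <= K.+1)%N ->
    (forall q, m - w <= q <= m + w -> `|f q - D'.[q]| <= e) ->
    forall q, m - w <= q <= m + w -> `|f q - D.[q]| <= e.
  move=> sD' H q qb; have /uniform_distP : (uniform_dist
      [set` `[m - w, m + w]%R] f (horner D) <= e%:E)%E.
    apply: (le_trans (HD _ sD')); apply/uniform_distP => x.
    by rewrite /= in_itv/=; exact: H.
  by apply; rewrite /= in_itv.
pose aff : {poly R} := w^-1 *: ('X - m%:P).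
pose iaff : {poly R} := w *: 'X + m%:P.
have saff : (size aff <= 2)%N.
  by rewrite (leq_trans (size_scale_leq _ _))// size_XsubC.
have siaff : (size iaff <= 2)%N.
  rewrite (leq_trans (size_polyD _ _))// geq_max.
  by rewrite (leq_trans (size_scale_leq _ _)) ?size_polyX// (leq_trans (size_polyC_leq1 _)).
pose G := D \Po iaff.
have sG : (size G <= K.+1)%N by rewrite (leq_trans (size_comp_affine _ siaff)).
have GE y : G.[y] = D.[m + w * y].
  by rewrite horner_comp hornerD hornerZ hornerX hornerC addrC.
have DB := best 0 (E * w) _ _.
have GB y : -1 <= y <= 1 -> `|G.[y]| <= 2 * E * w.
  move=> /andP[y1 y2]; rewrite GE.
  have yb : m - w <= m + w * y <= m + w by nra.
  have := DB _ _ _ yb; rewrite size_poly0 => /(_ isT) H.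
  have {}H : `|f (m + w * y) - D.[m + w * y]| <= E * w.
    by apply: H => q qb; rewrite horner0 subr0 fB.
  have -> : D.[m + w * y] = f (m + w * y) - (f (m + w * y) - D.[m + w * y]) by ring.
  by rewrite (le_trans (ler_normB _ _))//; have := fB _ yb; lra.
pose y0 : R := (p / E - m) / w.
have y0b : -1 <= y0 <= 0.
  rewrite /y0 ler_pdivlMr// ler_pdivrMr// mul0r subr_le0 am andbT.
  suff : m - p / E <= w by lra.
  have : c1 * L <= w.
    rewrite -ler_sqr ?nnegrE ?sqrtr_ge0 ?(ltW c1L_gt0)// U_radius_sqr expr2.
    by rewrite ler_wpM2l ?(ltW c1L_gt0)// le_max lexx orbT.
  by move=> cw; rewrite {1}/U_center; case: (leP (p / E)) => _; lra.
have y02 : 0 <= 1 - y0 ^+ 2 by case/andP: y0b => ? ?; nra.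
have [H sH HH] := hinge_approx K y0b.
pose err : R := E * w * (2 * Num.sqrt (1 - y0 ^+ 2) * (pi / K.+2%:R)).
exists G, err; split=> //.
- rewrite -/aff /G -comp_polyA.
  suff -> : iaff \Po aff = 'X by rewrite comp_polyXr.
  by rewrite /iaff /aff comp_polyD comp_polyZ comp_polyX comp_polyC scalerA mulfV// scale1r subrK.
- exact: sum_coef_le.
- split.
    by rewrite /err !mulr_ge0 ?(ltW E0) ?(ltW w0) ?sqrtr_ge0 ?divr_ge0 ?pi_ge0.
  (* For small [p], [m = w] and the left side is [p / E * (2 * w - p / E)]; otherwise [y0 = 0] and
     it is [w ^+ 2 = c1 * L * (p / E)]. *)
  have wy : w ^+ 2 * (1 - y0 ^+ 2) <= 2 * c1 * L * (p / E).
    have -> : w ^+ 2 * (1 - y0 ^+ 2) = w ^+ 2 - (p / E - m) ^+ 2.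
      by rewrite /y0; field; rewrite wn0 En0.
    rewrite U_radius_sqr /U_center; case: (leP (p / E) (c1 * L)) => _; last first.
      by rewrite subrr expr0n/= subr0; have := mulr_ge0 (ltW c1L_gt0) a0; lra.
    have := sqr_ge0 (p / E); have := mulr_ge0 (ltW c1L_gt0) a0; nra.
  have -> : err ^+ 2 = 4 * E ^+ 2 * (w ^+ 2 * (1 - y0 ^+ 2)) * (pi / K.+2%:R) ^+ 2.
    by move: (sqr_sqrtr y02); rewrite /err; set z := Num.sqrt _ => <-; ring.
  have pK : (pi / K.+2%:R) ^+ 2 <= 16 / K%:R ^+ 2 :> R.
    rewrite -[16](_ : 4 ^+ 2 = _); last by rewrite -natrX.
    rewrite -expr_div_n lerXn2r ?nnegrE ?divr_ge0 ?pi_ge0//.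
    rewrite ler_pM ?pi_ge0 ?invr_ge0//; first by have := @pihalf_lt2 R; lra.
    by rewrite lef_pV2 ?posrE// ler_nat leqW.
  apply: (@le_trans _ _ (4 * E ^+ 2 * (2 * c1 * L * (p / E)) * (16 / K%:R ^+ 2))).
    apply: ler_pM; rewrite ?sqr_ge0//.
      by apply: mulr_ge0; [exact: mulr_ge0 (ler0n _ 4) (sqr_ge0 _)|exact: mulr_ge0 (sqr_ge0 _) y02].
    by rewrite ler_wpM2l// mulr_ge0 ?sqr_ge0.
  rewrite le_eqVlt; apply/orP; left; apply/eqP; field.
  by rewrite En0 gt_eqF.
- apply: (best ((E * w) *: (H \Po aff))).
    rewrite (leq_trans (size_scale_leq _ _))//.
    by rewrite (leq_trans (size_comp_affine _ saff)).
  move=> q /andP[q1 q2].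
  rewrite hornerZ horner_comp /aff hornerZ hornerXsubC [w^-1 * _]mulrC.
  set y := (q - m) / w.
  have yb : -1 <= y <= 1 by rewrite ler_pdivlMr// ler_pdivrMr//; lra.
  have -> : f q = E * w * Num.max (y0 - y) 0.
    rewrite maxr_pMr ?mulr_ge0 ?(ltW w0) ?(ltW E0)// mulr0 /f; congr Num.max.
    by rewrite /y0 /y; field; rewrite wn0 En0.
  rewrite -mulrBr normrM ger0_norm ?mulr_ge0 ?(ltW w0) ?(ltW E0)//.
  by rewrite ler_wpM2l ?mulr_ge0 ?(ltW w0) ?(ltW E0)// HH.
Qed.
End symbol.

(** * Exceptional events in the two batches *)

Section events.
Context {R : realType} (eps : R) (n : nat).
Hypothesis n_gt1 : (1 < n)%N.
Local Notation E := (expR eps).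
(* Any large enough [c2] with [c1 = 4 * c2] would do: these values make every tail
   below at most [n ^- 2]. *)
Local Notation c1 := 128.
Local Notation c2 := 32.
Local Notation L := (@log_rate R n).
Let n_gt0 : (0 < n)%N. Proof. exact: ltnW. Qed.
Let nR_gt0 : 0 < n%:R :> R. Proof. by rewrite ltr0n. Qed.
Let L_gt0 : 0 < L. Proof. by rewrite divr_gt0// ln_nat_gt0. Qed.

(** Half the radius of [U c1 c2 p] for large [p]. A first frequency left of this interval leaves the
    other half for the deviation of the first batch, and the second batch may then deviate by
    [gap p] before clipping occurs. *)
Definition gap (p : R) : R := Num.sqrt (c2 * L * (p / E)) / 2.

(* [x] is a frequency observed in the first batch. *)
Definition not_misleading (p q x : R) : bool :=
  if U_right eps n c1 c2 p < x then p / E <= q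
  else if x \in U eps n c1 c2 p then
    U_center eps n c1 p - U_radius eps n c1 p <= q
      <= U_center eps n c1 p + U_radius eps n c1 p
  else (c1 * L < p / E) && (q <= p / E - gap p).

(* [x] is a frequency observed in the second batch: if the linear estimator is
   used, then its clipping at 0 is inactive. *)
Definition unclipped (p q x : R) : bool :=
  [&& c1 * L < p / E & q <= p / E - gap p] ==> (x <= p / E).

Section tails.
Context {S : nat} (Q : probvec R S) (i : 'I_S).
Local Notation mu := (batch_law Q n).
Local Notation q := (Q i).
Local Notation freq s := (qhat R n s i).
Local Notation rare := (expR (- (2 * ln n%:R)) : R).

(** A deviation [u] at scale [a] has the exponent [n * u ^+ 2 / (4 * a)], and the last hypothesis
    makes it at least [2 * ln n]. *)
Lemma freq_tail_ge (a u y : R) : 0 < a -> 0 <= u <= a / 2 -> q <= a ->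
  q + u <= y -> 8 * a * L <= u ^+ 2 ->
  (mu [set s | (y <= freq s)%R] <= rare%:E)%E.
Proof.
move=> a0 /andP[u0 ua] qa qy au.
have -> : [set s | y <= freq s] = [set s | n%:R * y <= (count_mem i s)%:R].
  by apply/funext => s /=; rewrite /qhat ler_pdivlMr// mulrC.
apply: (le_trans (@batch_tail_ge _ _ Q n n_gt0 i (n%:R * a) (n%:R * u) (n%:R * y) _ _ _ _)).
- exact: mulr_gt0.
- by rewrite mulr_ge0//= -mulrA ler_wpM2l.
- by rewrite ler_wpM2l.
- by rewrite -mulrDr ler_wpM2l.
rewrite lee_fin ler_expR lerN2.
have -> : (n%:R * u) ^+ 2 / (4 * (n%:R * a)) = n%:R * u ^+ 2 / (4 * a).
  by field; rewrite !gt_eqF.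
rewrite ler_pdivlMr ?mulr_gt0//.
have -> : ln n%:R = n%:R * L by rewrite /log_rate; field; rewrite gt_eqF.
have -> : 2 * (n%:R * L) * (4 * a) = n%:R * (8 * a * L) by ring.
by rewrite ler_wpM2l.
Qed.

Lemma freq_tail_le (a u y : R) : 0 < a -> 0 <= u <= a -> a <= q ->
  y + u <= a -> 8 * a * L <= u ^+ 2 ->
  (mu [set s | (freq s <= y)%R] <= rare%:E)%E.
Proof.
move=> a0 /andP[u0 ua] qa qy au.
have -> : [set s | freq s <= y] = [set s | (count_mem i s)%:R <= n%:R * y].
  by apply/funext => s /=; rewrite /qhat ler_pdivrMr// mulrC.
apply: (le_trans (@batch_tail_le _ _ Q n n_gt0 i (n%:R * a) (n%:R * u) (n%:R * y) _ _ _ _)).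
- exact: mulr_gt0.
- by rewrite mulr_ge0//= ler_wpM2l.
- by rewrite ler_wpM2l.
- by rewrite -mulrDr ler_wpM2l.
rewrite lee_fin ler_expR lerN2.
have -> : (n%:R * u) ^+ 2 / (4 * (n%:R * a)) = n%:R * u ^+ 2 / (4 * a).
  by field; rewrite !gt_eqF.
rewrite ler_pdivlMr ?mulr_gt0//.
have -> : ln n%:R = n%:R * L by rewrite /log_rate; field; rewrite gt_eqF.
have -> : 2 * (n%:R * L) * (4 * a) = n%:R * (8 * a * L) by ring.
by rewrite ler_wpM2l.
Qed.

Let rare_ge0 : (0 <= rare%:E)%E. Proof. by rewrite lee_fin expR_ge0. Qed.

(** [C] is a condition on the law alone, so the event is empty or equal to [A]. Wrong decisions then
    form a union that covers every position of [q]. *)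
Lemma measure_imply (C : bool) (A : set (batch S)) :
  (C -> (mu A <= rare%:E)%E) -> (mu [set s | C /\ A s] <= rare%:E)%E.
Proof.
case: C => [/(_ isT) H|_].
  by apply: le_trans H; apply: le_measure; rewrite ?inE// => s [].
suff -> : [set s | false /\ A s] = set0 by rewrite measure0.
by apply/seteqP; split => s // -[].
Qed.

Lemma measureU_le (A B : set (batch S)) (x y : R) :
  (mu A <= x%:E)%E -> (mu B <= y%:E)%E -> (mu (A `|` B) <= (x + y)%:E)%E.
Proof.
move=> Ax By; rewrite EFinD; apply: le_trans (leeD Ax By).
exact: (@measureU2 _ _ _ mu).
Qed.

(** [c1 = 4 * c2] makes the outer radius twice the inner one, [s2], and the threshold
    [c1 * L < p / E] gives [4 * s2 ^+ 2 <= (p / E) ^+ 2]. *)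
Lemma gapE p : 0 <= p -> c1 * L < p / E ->
  let s2 := Num.sqrt (c2 * L * (p / E)) in
  [/\ s2 ^+ 2 = c2 * L * (p / E), 0 < s2, s2 <= p / E / 2,
      U_center eps n c1 p = p / E & U_radius eps n c1 p = 2 * s2].
Proof.
move=> p0 pL s2.
have a0 : 0 < p / E by apply: lt_trans pL; rewrite mulr_gt0.
have s2E : s2 ^+ 2 = c2 * L * (p / E).
  by rewrite sqr_sqrtr//; apply: mulr_ge0; [rewrite mulr_ge0// ltW|exact: ltW].
have s20 : 0 < s2 by rewrite sqrtr_gt0; apply: mulr_gt0 => //; exact: mulr_gt0.
have mE : U_center eps n c1 p = p / E by rewrite /U_center max_l// ltW.
split=> //.
  rewrite -ler_sqr ?nnegrE ?(ltW s20) ?divr_ge0 ?(ltW a0)// s2E.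
  have := mulr_gt0 a0 (_ : 0 < p / E - c1 * L); rewrite subr_gt0 => /(_ pL).
  by rewrite expr_div_n; lra.
rewrite /U_radius mE -[RHS]ger0_norm ?mulr_ge0 ?(ltW s20)// -sqrtr_sqr.
by congr Num.sqrt; rewrite exprMn s2E /log_rate; ring.
Qed.

Lemma U_small p c : p / E <= c1 * L ->
  U_left eps n c1 c p = 0 /\ U_right eps n c1 c p = (c1 + c) * L.
Proof.
move=> pL; rewrite /U_left /U_right small_prob pL; split=> //.
by rewrite /log_rate; ring.
Qed.

Lemma U_large p c : c1 * L < p / E ->
  U_left eps n c1 c p = p / E - Num.sqrt (c * L * (p / E)) /\
  U_right eps n c1 c p = p / E + Num.sqrt (c * L * (p / E)).
Proof.
move=> pL; rewrite /U_left /U_right small_prob leNgt pL/=.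
have -> : c * expR (- eps) * p * ln n%:R / n%:R = c * L * (p / E).
  by rewrite expRN /log_rate; ring.
by rewrite expRN [_^-1 * p]mulrC.
Qed.

Lemma U_small_center p : p / E <= c1 * L ->
  U_center eps n c1 p = c1 * L /\ U_radius eps n c1 p = c1 * L.
Proof.
move=> pL; have mE : U_center eps n c1 p = c1 * L by rewrite /U_center max_r.
split=> //; rewrite /U_radius mE -expr2 sqrtr_sqr ger0_norm//.
by rewrite mulr_ge0// ltW.
Qed.

Lemma prob_misleading p : 0 <= p ->
  (mu [set s | ~~ not_misleading p q (freq s)] <= (4 * rare)%:E)%E.
Proof.
move=> p0; have q0 : 0 <= q by exact: prob_of_ge0.
have L0 : 0 < L by exact: L_gt0.
have r0 : 0 <= rare by exact: expR_ge0.
have freq0 s : 0 <= freq s by rewrite divr_ge0.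
have [pL|pL] := leP (p / E) (c1 * L).
  have [mE wE] := U_small_center pL.
  have [lE rE] := U_small c2 pL.
  pose A1 := [set s | q < p / E /\ [set s | (c1 + c2) * L <= freq s] s].
  pose A2 := [set s | c1 * L + c1 * L < q /\ [set s | freq s <= (c1 + c2) * L] s].
  (* The requirement on the deviation holds with equality, [8 * c1 = c2 ^+ 2]: with [c1 = 4 * c2] it
     asks for [c2 >= 32]. *)
  have H1 : (mu A1 <= rare%:E)%E.
    apply: measure_imply => qp; apply: (@freq_tail_ge (c1 * L) (c2 * L)).
    - exact: mulr_gt0.
    - by lra.
    - by lra.
    - by lra.
    - by have := sqr_ge0 L; lra.
  have H2 : (mu A2 <= rare%:E)%E.
    apply: measure_imply => qp; apply: (@freq_tail_le (c1 * L + c1 * L) (96 * L)).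
    - by lra.
    - by lra.
    - by lra.
    - by lra.
    - by have := sqr_ge0 L; lra.
  apply: (@le_trans _ _ (mu (A1 `|` A2))).
    apply: le_measure; rewrite ?inE// => s /=.
    rewrite /not_misleading rE mE wE; case: ltP => [h|h].
      by rewrite -ltNge => qp; left; split=> //=; exact: ltW.
    rewrite in_itv/= lE rE freq0 h/= subrr q0/= -ltNge => h2.
    by right.
  apply: (le_trans (measureU_le H1 H2)); rewrite lee_fin; lra.
have [s2E s20 s2a mE wE] := gapE p0 pL.
have [lE rE] := U_large c2 pL.
move: s2E s20 s2a mE wE lE rE; set s2 := Num.sqrt _ => s2E s20 s2a mE wE lE rE.
set a := p / E in pL s2E s2a mE lE rE.
have a0 : 0 < a by apply: lt_trans pL; rewrite mulr_gt0.
have La : 0 < L * a by rewrite mulr_gt0.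
(* One event for each wrong decision: [A1] answers 0, [A2] and [A3] take the polynomial although [q]
   is right or left of the outer interval, [A4] takes the linear estimator too close to the kink. *)
pose A1 := [set s | q < a /\ [set s | a + s2 <= freq s] s].
pose A2 := [set s | a + 2 * s2 < q /\ [set s | freq s <= a + s2] s].
pose A3 := [set s | q < a - 2 * s2 /\ [set s | a - s2 <= freq s] s].
pose A4 := [set s | a - s2 / 2 < q /\ [set s | freq s <= a - s2] s].
have H1 : (mu A1 <= rare%:E)%E.
  apply: measure_imply => qp; apply: (@freq_tail_ge a s2); lra.
have H2 : (mu A2 <= rare%:E)%E.
  apply: measure_imply => qp; apply: (@freq_tail_le (a + 2 * s2) s2); try lra.
  have : L * s2 <= L * (a / 2) by rewrite ler_wpM2l// ltW.
  by lra.
have H3 : (mu A3 <= rare%:E)%E.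
  apply: measure_imply => qp; apply: (@freq_tail_ge a s2); lra.
have H4 : (mu A4 <= rare%:E)%E.
  apply: measure_imply => qp; apply: (@freq_tail_le (a - s2 / 2) (s2 / 2)); try lra.
  have : 0 <= L * s2 by rewrite mulr_ge0// ltW.
  by lra.
apply: (@le_trans _ _ (mu (A1 `|` A2 `|` A3 `|` A4))).
  apply: le_measure; rewrite ?inE// => s /=.
  rewrite /not_misleading rE mE wE /gap -/a -/s2; case: ltP => [h|h].
    by rewrite -ltNge => qp; do 3 left; split=> //=; exact: ltW.
  rewrite in_itv/= lE rE h andbT; case: (leP (a - s2) (freq s)) => [h2|h2].
    rewrite negb_and -!ltNge => /orP[h3|h3]; first by left; right.
    by left; left; right.
  by rewrite pL/= -ltNge => h3; right; split=> //=; exact: ltW.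
apply: le_trans (measureU_le (measureU_le (measureU_le H1 H2) H3) H4) _.
by rewrite lee_fin; lra.
Qed.

Lemma prob_clipped p : 0 <= p ->
  (mu [set s | ~~ unclipped p q (freq s)] <= rare%:E)%E.
Proof.
move=> p0.
have -> : [set s | ~~ unclipped p q (freq s)] =
    [set s | ((c1 * L < p / E) && (q <= p / E - gap p)) /\
       [set s | p / E < freq s] s].
  apply/funext => s /=; apply/propext; rewrite /unclipped negb_imply -ltNge.
  by split=> [/andP[]|[-> ->]].
apply: measure_imply => /andP[pL qp].
have [s2E s20 s2a _ _] := gapE p0 pL.
have a0 : 0 < p / E by apply: lt_trans pL; rewrite mulr_gt0.
apply: (@le_trans _ _ (mu [set s | p / E <= freq s])).
  by apply: le_measure; rewrite ?inE// => s /= /ltW.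
(* Again a case of equality: [gap p ^+ 2 = 8 * (p / E) * L] for [c2 = 32]. *)
apply: (@freq_tail_ge (p / E) (gap p)) => //; rewrite /gap.
- by apply/andP; split; lra.
- by move: qp; rewrite /gap; lra.
- by move: qp; rewrite /gap; lra.
- by rewrite expr_div_n s2E; lra.
Qed.

End tails.
End events.

(** * Mean squared error *)

Lemma sqr_sum_le (R : realType) (S : nat) (e : 'I_S -> R) :
  (\sum_i e i) ^+ 2 <= S%:R * \sum_i e i ^+ 2.
Proof.
apply: (@le_trans _ _ (\sum_(i < S) \sum_(j < S) ((e i) ^+ 2 + (e j) ^+ 2) / 2)).
  rewrite expr2 mulr_suml; apply: ler_sum => i _.
  rewrite mulr_sumr; apply: ler_sum => j _.
  by have := sqr_ge0 (e i - e j); nra.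
rewrite (eq_bigr (fun i => (S%:R * e i ^+ 2 + \sum_j e j ^+ 2) / 2)); last first.
  by move=> i _; rewrite -mulr_suml big_split/= sumr_const card_ord mulr_natl.
rewrite -mulr_suml big_split/= -mulr_sumr sumr_const card_ord -[X in _ + X]mulr_natl.
by set x := S%:R * _; rewrite le_eqVlt; apply/orP; left; apply/eqP; field.
Qed.

(** The product sigma-algebra is generated by rectangles; it contains the singletons, and there are
    countably many pairs. Tonelli's theorem asks for this measurability. *)
Lemma measurable_batch_pair (S : nat) (A : set (batch S * batch S)) : measurable A.
Proof.
apply: countable_measurable => [[s t]|].
  have -> : [set (s, t)] = [set s] `*` [set t].
    by apply/seteqP; split=> [[u v] [-> ->]|[u v] [/= -> ->]].
  exact: measurableX.
exact: (@countableP (seq 'I_S * seq 'I_S)%type).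
Qed.

Section mean_square.
Context {R : realType} (eps : R) (n : nat).
Hypothesis eps_ge0 : 0 <= eps.
Hypothesis n_gt1 : (1 < n)%N.
Local Notation E := (expR eps).
Local Notation c1 := 128.
Local Notation c2 := 32.
Local Notation L := (@log_rate R n).
Let n_gt0 : (0 < n)%N. Proof. exact: ltnW. Qed.
Let nR_gt0 : 0 < n%:R :> R. Proof. by rewrite ltr0n. Qed.
Let L_gt0 : 0 < L. Proof. by rewrite divr_gt0// ln_nat_gt0. Qed.

Variable K : nat.
Hypothesis K_gt0 : (0 < K)%N.
Hypothesis K_le : 2 * K%:R <= c1 * ln n%:R :> R.

Section fixed_law.
Context {S : nat} (Q : probvec R S).
Local Notation mu := (batch_law Q n).

Lemma poly_mean_X i : poly_mean Q n i 'X = n%:R * Q i.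
Proof.
have := poly_mean_mecke Q n_gt0 i 1.
by rewrite comp_polyC mulr1 poly_mean1// mulr1.
Qed.

Lemma poly_mean_X2 i : poly_mean Q n i ('X ^+ 2) = n%:R * Q i * (n%:R * Q i + 1).
Proof.
have := poly_mean_mecke Q n_gt0 i ('X + 1).
rewrite comp_polyD comp_polyX comp_polyC subrK -expr2 => ->.
by rewrite poly_meanD// poly_mean_X poly_mean1.
Qed.

Definition poly_approx_var (p : R) : R :=
  2 ^+ K * (2 * E * U_radius eps n c1 p * expR (2 * K%:R)) ^+ 2.

(** Each decision fits the same two bounds: 0 is exact as [q >= p / E]; the linear estimator is
    unbiased as [q <= p / E], with variance [E ^+ 2 * q / n]; the third has the bias of [D_poly] at
    [q], and its variance is bounded by its second moment. *)
Lemma symbol_estimator (i : 'I_S) (p x : R) : 0 <= p ->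
  not_misleading eps n p (Q i) x -> exists Y : {poly R},
  [/\ (poly_mean Q n i Y - Num.max (p - E * Q i) 0) ^+ 2
        <= 128 * c1 * E * p * L / K%:R ^+ 2,
      poly_mean Q n i (Y ^+ 2) - poly_mean Q n i Y ^+ 2
        <= poly_approx_var p + E ^+ 2 * Q i / n%:R
    & forall c : nat, unclipped eps n p (Q i) (c%:R / n%:R) ->
        delta eps n K c1 c2 p x (c%:R / n%:R) = Y.[c%:R]].
Proof.
move=> p0; have q0 : 0 <= Q i by exact: prob_of_ge0.
have E0 : 0 < E by exact: expR_gt0.
have KR : 0 < K%:R :> R by rewrite ltr0n.
have L0 : 0 < L by exact: L_gt0.
have n0 : n%:R != 0 :> R by rewrite gt_eqF.
have err0 : 0 <= 128 * c1 * E * p * L / K%:R ^+ 2.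
  apply: divr_ge0 (exprn_ge0 _ (ltW KR)); apply: mulr_ge0 (ltW L0).
  by apply: mulr_ge0 p0; apply: mulr_ge0 (ltW E0).
have v1 : 0 <= poly_approx_var p by rewrite /poly_approx_var mulr_ge0 ?sqr_ge0 ?exprn_ge0.
have v2 : 0 <= E ^+ 2 * Q i / n%:R by rewrite divr_ge0// mulr_ge0 ?sqr_ge0.
rewrite /not_misleading /delta; case: ifPn => [_ pq|_].
  exists 0; have M0 : poly_mean Q n i 0 = 0.
    by have := poly_meanZ Q n_gt0 i 0 0; rewrite scale0r mul0r.
  have f0 : Num.max (p - E * Q i) 0 = 0.
    by rewrite max_r// subr_le0 -ler_pdivrMl// mulrC.
  split=> [||c _]; last by rewrite horner0.
  - by rewrite M0 f0 subrr expr0n.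
  - by rewrite expr0n/= M0 expr0n subrr addr_ge0.
case: ifPn => [_ qU|_ /andP[pL qgap]]; last first.
  exists (p%:P - (E / n%:R) *: 'X).
  have M1 : poly_mean Q n i p%:P = p.
    by rewrite -[p%:P]mulr1 mul_polyC poly_meanZ// poly_mean1// mulr1.
  have MY : poly_mean Q n i (p%:P - (E / n%:R) *: 'X) = p - E * Q i.
    by rewrite -scaleNr poly_meanD// poly_meanZ// poly_mean_X M1; field.
  have fE : Num.max (p - E * Q i) 0 = p - E * Q i.
    rewrite max_l// subr_ge0 -ler_pdivlMl// mulrC (le_trans qgap)// lerBlDr lerDl.
    by rewrite /gap divr_ge0 ?sqrtr_ge0.
  split.
  - by rewrite MY fE subrr expr0n.
  - have -> : (p%:P - (E / n%:R) *: 'X) ^+ 2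
      = (p ^+ 2) *: 1 + (- (2 * p * (E / n%:R))) *: 'X + (E / n%:R) ^+ 2 *: 'X ^+ 2.
      by rewrite -!mul_polyC !(polyCM, polyCN, polyC_exp); ring.
    rewrite MY !poly_meanD// !poly_meanZ// poly_mean_X poly_mean_X2 poly_mean1//.
    apply: (@le_trans _ _ (E ^+ 2 * Q i / n%:R)); last by rewrite lerDr.
    by rewrite le_eqVlt; apply/orP; left; apply/eqP; field.
  - move=> c; rewrite /unclipped pL qgap/= => cp.
    rewrite max_l; last by rewrite subr_ge0 -ler_pdivlMl// [_^-1 * p]mulrC.
    by rewrite hornerD hornerN hornerZ hornerX hornerC; field.
have [G [err [sG DE GB [err_ge0 err2] Herr]]] :=
  D_poly_spec eps n_gt1 (ltr0n R 128 : 0 < c1) p0 K_gt0.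
set m := U_center eps n c1 p in qU DE Herr; set w := U_radius eps n c1 p in qU DE Herr GB.
have w0 : 0 < w by rewrite U_radius_gt0.
have wm : w <= m by rewrite U_radius_le_center.
have w2 : w ^+ 2 = c1 * L * m by rewrite U_radius_sqr.
have W0 : 0 < n%:R * w by rewrite mulr_gt0.
have dist : `|n%:R * Q i - n%:R * m| <= n%:R * w.
  rewrite -mulrBr normrM ger0_norm// ler_wpM2l// ler_norml.
  by case/andP: qU => ? ?; lra.
(* The degree meets the radius here: [q <= 2 * m] on the interval and [w ^+ 2 = c1 * L * m], so the
   bound amounts to [2 * K <= c1 * ln n]. *)
have lK : n%:R * Q i * K%:R <= (n%:R * w) ^+ 2.
  have qm : Q i <= 2 * m by case/andP: qU => ? ?; lra.
  have m0 : 0 < m by lra.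
  apply: (@le_trans _ _ (n%:R * (2 * m) * K%:R)).
    by rewrite ler_wpM2r// ler_wpM2l.
  have -> : (n%:R * w) ^+ 2 = n%:R * m * (c1 * ln n%:R).
    by rewrite exprMn w2 /log_rate; field.
  have -> : n%:R * (2 * m) * K%:R = n%:R * m * (2 * K%:R) by ring.
  by rewrite ler_wpM2l// mulr_ge0// ltW.
have [MY MY2] := poly_mean_charlier_comb n_gt0 (ltW W0) dist W0 lK GB.
set Y := \sum_(j < K.+1) _ in MY MY2.
have MYD : poly_mean Q n i Y = (D_poly eps n K c1 p).[Q i].
  rewrite MY DE horner_comp hornerZ hornerXsubC (horner_coef_wide _ sG).
  apply: eq_bigr => j _; congr (_ * _ ^+ _); field.
  by rewrite n0 gt_eqF.
exists Y; split.
- rewrite MYD; apply: le_trans err2.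
  rewrite -[leLHS]real_normK ?num_real// lerXn2r ?nnegrE ?normr_ge0//.
  by rewrite distrC Herr.
- rewrite lerBlDr (le_trans MY2)//.
  rewrite /poly_approx_var -/w -addrA lerDl.
  by rewrite addr_ge0 ?sqr_ge0.
- move=> c _; rewrite (D_tilde_charlier _ n_gt0 _ sG DE) ?gt_eqF//.
  by rewrite /Y horner_sum; apply: eq_bigr => j _; rewrite hornerZ.
Qed.

End fixed_law.

Section fixed_pair.
Context {S : nat} (P Q : probvec R S).
Local Notation mu := (batch_law Q n).
Local Notation rare := (expR (- (2 * ln n%:R)) : R).

(** Squared bias after Cauchy-Schwarz, then the variances of the polynomial estimators, then those
    of the linear ones. *)
Definition good_bound : R := S%:R * (128 * c1 * E * L / K%:R ^+ 2)
  + 2 ^+ K * (2 * E * expR (2 * K%:R)) ^+ 2 * (c1 * L + S%:R * (c1 * L) ^+ 2)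
  + E ^+ 2 / n%:R.

Lemma sum_approx_var : \sum_i (poly_approx_var (P i) + E ^+ 2 * Q i / n%:R)
  <= 2 ^+ K * (2 * E * expR (2 * K%:R)) ^+ 2 * (c1 * L + S%:R * (c1 * L) ^+ 2)
  + E ^+ 2 / n%:R.
Proof.
have L0 : 0 < L by exact: L_gt0.
have cL0 : 0 <= c1 * L by apply: mulr_ge0 (ltW L0).
rewrite big_split/= lerD//; last first.
  by rewrite -mulr_suml -mulr_sumr prob_of_sum1 mulr1.
rewrite /poly_approx_var -mulr_sumr -mulrA ler_wpM2l ?exprn_ge0//.
rewrite (eq_bigr (fun i => (2 * E * expR (2 * K%:R)) ^+ 2
    * U_radius eps n c1 (P i) ^+ 2)); last by move=> i _; ring.
rewrite -mulr_sumr ler_wpM2l ?sqr_ge0//.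
(* The maximum in [U_center] is at most the sum [P i + c1 * L]. *)
apply: (@le_trans _ _ (\sum_(i < S) (c1 * L * P i + (c1 * L) ^+ 2))); last first.
  rewrite big_split/= -mulr_sumr prob_of_sum1 mulr1.
  by rewrite sumr_const card_ord -[X in _ + X <= _]mulr_natl lexx.
apply: ler_sum => i _; rewrite U_radius_sqr// expr2 -mulrDr ler_wpM2l//.
have P0 : 0 <= P i by exact: prob_of_ge0.
rewrite /U_center ge_max lerDr P0 andbT.
apply: (@le_trans _ _ (P i)); last by rewrite lerDl.
rewrite ler_pdivrMr ?expR_gt0// ler_peMr//.
by rewrite -[leLHS](@expR0 R) ler_expR.
Qed.

Lemma clip_dist (z d : R) : 0 <= d <= 1 ->
  `|Num.max 0 (Num.min 1 z) - d| ^+ 2 <= (z - d) ^+ 2 /\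
  `|Num.max 0 (Num.min 1 z) - d| ^+ 2 <= 1.
Proof.
move=> /andP[d0 d1]; rewrite real_normK ?num_real//.
by case: (leP 1 z) => z1; [|case: (leP 0 z) => z0]; rewrite ?(max_r ler01);
  split; nra.
Qed.

Lemma eps_div_01 : 0 <= eps_div eps P Q <= 1.
Proof.
rewrite /eps_div sumr_ge0/= => [|i _]; last by rewrite le_max lexx orbT.
rewrite -(prob_of_sum1 P); apply: ler_sum => i _.
by rewrite ge_max prob_of_ge0 andbT gerBl mulr_ge0 ?expR_ge0 ?prob_of_ge0.
Qed.

Local Notation sq_err b1 b2 := (`|d_hat eps n K c1 c2 P (b1, b2) - eps_div eps P Q| ^+ 2).
Let misled := [set b : batch S | exists i, ~~ not_misleading eps n (P i) (Q i) (qhat R n b i)].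
Let clipped := [set b : batch S | exists i, ~~ unclipped eps n (P i) (Q i) (qhat R n b i)].

Lemma measure_exists (F : 'I_S -> set (batch S)) (x : R) :
  (forall i, (mu (F i) <= x%:E)%E) -> (mu [set s | exists i, F i s] <= (S%:R * x)%:E)%E.
Proof.
move=> Fx.
have -> : [set s | exists i, F i s] = \big[setU/set0]_(i <- index_enum 'I_S) F i.
  rewrite -bigcup_seq; apply/seteqP; split=> s /= [i].
    by move=> Fi; exists i => //; exact: mem_index_enum.
  by move=> _ Fi; exists i.
have -> : S%:R * x = \sum_(i < S) x by rewrite sumr_const card_ord mulr_natl.
rewrite -sumEFin; elim: (index_enum _) => [|i r IH].
  by rewrite !big_nil measure0.
rewrite !big_cons; apply: le_trans (leeD (Fx i) IH).
exact: (@measureU2 _ _ _ mu).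
Qed.

Lemma mean_sq_err_good (b1 : batch S) : ~ misled b1 ->
  (\int[mu]_b2 (sq_err b1 b2)%:E <= (S%:R * rare + good_bound)%:E)%E.
Proof.
move=> good.
have {}good i : not_misleading eps n (P i) (Q i) (qhat R n b1 i).
  by apply/negP => /negP H; apply: good; exists i.
(* The polynomials depend on [b1] only, so they are fixed in the integral over [b2]. *)
have [Y HY] := choice (fun i => symbol_estimator (prob_of_ge0 P i) (good i)).
have [iY EY] := batch_mean_sqr_sum Q n_gt0 Y (eps_div eps P Q).
apply: (@le_trans _ _ (\int[mu]_b2 ((\1_clipped b2)%:E
   + ((\sum_i (Y i).[(count_mem i b2)%:R] - eps_div eps P Q) ^+ 2)%:E))%E).
  apply: ge0_le_integral => // b2 _.
  rewrite -EFinD lee_fin indicE.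
  have [H1 H2] := clip_dist (\sum_i delta eps n K c1 c2 (P i)
    (qhat R n b1 i) (qhat R n b2 i)) eps_div_01.
  case: (boolP (b2 \in clipped)) => [_|b2c].
    by rewrite (le_trans H2)// lerDl sqr_ge0.
  rewrite add0r; apply: (le_trans H1).
  rewrite (eq_bigr (fun i => (Y i).[(count_mem i b2)%:R])) ?lexx// => i _.
  have [_ _] := HY i; apply; apply/negP => /negP H.
  by move/negP: b2c; apply; rewrite inE; exists i.
rewrite ge0_integralD//; last by move=> b2 _; rewrite lee_fin sqr_ge0.
rewrite [leRHS]EFinD; apply: leeD.
  rewrite integral_indic// setIT; apply: measure_exists => i.
  by apply: prob_clipped => //; exact: prob_of_ge0.
rewrite EY lee_fin /good_bound -addrA lerD//; last first.
  apply: le_trans sum_approx_var; apply: ler_sum => i _.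
  by have [_] := HY i.
rewrite /eps_div -sumrB (le_trans (sqr_sum_le _))// ler_wpM2l//.
apply: (@le_trans _ _ (\sum_(i < S) 128 * c1 * E * P i * L / K%:R ^+ 2)).
  by apply: ler_sum => i _; have [] := HY i.
rewrite (eq_bigr (fun i => (128 * c1 * E * L / K%:R ^+ 2) * P i)).
  by rewrite -mulr_sumr prob_of_sum1 mulr1.
by move=> i _; ring.
Qed.

(** The 5 counts exceptional events per symbol: at most four misleading ones in the first batch and
    a clipping in the second. *)
Lemma mean_sq_error_le : (mean_sq_error eps n K c1 c2 P Q
  <= (S%:R * (5 * rare) + good_bound)%:E)%E.
Proof.
have L0 : 0 < L by exact: L_gt0.
have r0 : 0 <= rare by exact: expR_ge0.
have gb0 : 0 <= good_bound.
  have cL0 : 0 <= c1 * L by apply: mulr_ge0 (ltW L0).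
  apply: addr_ge0; last by rewrite divr_ge0 ?sqr_ge0.
  apply: addr_ge0.
    apply: mulr_ge0 => //; apply: divr_ge0 (sqr_ge0 _); apply: mulr_ge0 (ltW L0).
    by rewrite mulr_ge0 ?expR_ge0.
  apply: mulr_ge0; first by rewrite mulr_ge0 ?sqr_ge0 ?exprn_ge0.
  by rewrite addr_ge0// mulr_ge0 ?sqr_ge0.
rewrite /mean_sq_error unlock fubini_tonelli1/=; last 2 first.
- by move=> mT B mB; exact: measurable_batch_pair.
- by move=> b; rewrite lee_fin exprn_ge0.
apply: (@le_trans _ _ (\int[mu]_b1 ((\1_misled b1)%:E
   + (S%:R * rare + good_bound)%:E))%E).
  apply: ge0_le_integral => // [b1 _|b1 _].
    by apply: integral_ge0 => b2 _; rewrite lee_fin exprn_ge0.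
  rewrite indicE; case: (boolP (b1 \in misled)) => [_|b1m].
    apply: (@le_trans _ _ 1%E); last first.
      by rewrite -EFinD lee_fin lerDl addr_ge0// mulr_ge0.
    apply: (@le_trans _ _ (\int[mu]_b2 (cst 1%E b2))%E).
      apply: ge0_le_integral => // b2 _.
      by rewrite lee_fin (proj2 (clip_dist _ eps_div_01)).
    by rewrite integral_cst// mul1e; exact: probability_le1.
  rewrite add0e; apply: mean_sq_err_good.
  by move=> H; move/negP: b1m; apply; rewrite inE.
rewrite ge0_integralD//; last by move=> b1 _; rewrite lee_fin addr_ge0// mulr_ge0.
rewrite integral_indic// setIT (integral_cst mu measurableT (S%:R * rare + good_bound)%:E).
have -> : S%:R * (5 * rare) + good_bound
   = S%:R * (4 * rare) + (S%:R * rare + good_bound) by ring.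
rewrite [leRHS]EFinD; apply: leeD.
  by apply: measure_exists => i; apply: prob_misleading => //; exact: prob_of_ge0.
by rewrite -[leRHS]mule1 lee_wpmul2l ?probability_le1// lee_fin addr_ge0// mulr_ge0.
Qed.

End fixed_pair.
End mean_square.

(** Serves when [n] is so small that the degree rounds to 0. *)
Lemma mean_sq_error_le1 (R : realType) (eps : R) (n S K : nat) (c1 c2 : R)
  (P Q : probvec R S) : (mean_sq_error eps n K c1 c2 P Q <= 1)%E.
Proof.
rewrite /mean_sq_error unlock.
set PP := (_ \x _)%E.
apply: (@le_trans _ _ (\int[PP]_b (cst 1%E b))%E).
  apply: ge0_le_integral => //.
  - by move=> mT B mB; exact: measurable_batch_pair.
  - by move=> b _; rewrite lee_fin (proj2 (clip_dist _ (eps_div_01 eps P Q))).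
by rewrite integral_cst// mul1e; exact: probability_le1.
Qed.

Lemma expr_le_expR (R : realType) (a x : R) (k : nat) : 0 < a -> 0 <= x ->
  x ^+ k <= a ^+ k * expR (k%:R * (x / a)).
Proof.
move=> a0 x0; rewrite expRM_natl -exprMn lerXn2r ?nnegrE ?mulr_ge0 ?expR_ge0 ?(ltW a0)//.
rewrite -ler_pdivrMl// [_^-1 * _]mulrC.
by have := expR_ge1Dx (x / a); lra.
Qed.

(** * Choice of the constants and the final rate *)

Section rate.
Context {R : realType} (C' eps : R).
Hypothesis C'_gt0 : 0 < C'.
Hypothesis eps_ge0 : 0 <= eps.
Local Notation E := (expR eps).

(** The variance loses a factor [n ^ de]. The bound [1 / (2 * C')] makes [S >= E * n ^ (2 * de)]:
    one factor [n ^ de] pays for the loss, the other for powers of the logarithm. In the part of the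
    variance that already carries [S], it is [n] that pays, whence the bound 1/2. *)
Definition rate_exp : R := Num.min (1 / 2) (1 / (2 * C')).
Local Notation de := rate_exp.
(** The 5 comes from [2 ^+ K * expR (2 * K) ^+ 2 <= expR (5 * K)]. *)
Definition degree_const : R := de / 5.
Local Notation c3 := degree_const.
Definition rate_const : R := 256 ^+ 2 / c3 ^+ 2 + 8 * 256 / de ^+ 2 + 256 ^+ 2 * 216 * E
  + 1 / (2 * de) + 5 + expR (1 / c3) / c3.

Lemma rate_exp_gt0 : 0 < de.
Proof. by rewrite lt_min !divr_gt0// mulr_gt0. Qed.

Lemma degree_const_gt0 : 0 < c3.
Proof. by rewrite divr_gt0// rate_exp_gt0. Qed.

Variables (S n : nat).
Hypothesis S_gt0 : (0 < S)%N.
Hypothesis n_gt1 : (1 < n)%N.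
Hypothesis nS : ln n%:R <= C' * (ln S%:R - eps).
Local Notation l := (ln n%:R : R).
Local Notation T := (E * S%:R / (n%:R * l)).

Lemma support_size_ge : E * expR (2 * de * l) <= S%:R.
Proof.
have S0 : 0 < S%:R :> R by rewrite ltr0n.
have l0 : 0 < l by exact: ln_nat_gt0.
rewrite -expRD -[leRHS](lnK (_ : S%:R \in Num.pos)) ?posrE// ler_expR.
have : de * l <= 1 / (2 * C') * l by rewrite ler_wpM2r ?(ltW l0)// ge_min lexx orbT.
have : l / C' <= ln S%:R - eps by rewrite ler_pdivrMr// mulrC.
have -> : 1 / (2 * C') * l = l / C' / 2 by field; rewrite gt_eqF.
lra.
Qed.

Lemma target_ge0 : 0 <= T.
Proof.
by rewrite divr_ge0 ?mulr_ge0 ?expR_ge0// ltW// ln_nat_gt0.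
Qed.

(** Here [n] and [ln n] are bounded in terms of [c3], while [E] and [S] are at least 1, so the
    target stays away from 0. *)
Lemma small_sample_bound : c3 * l < 1 -> 1 <= expR (1 / c3) / c3 * T.
Proof.
move=> cl; have c0 := degree_const_gt0.
have l0 : 0 < l by exact: ln_nat_gt0.
have n0 : 0 < n%:R :> R by rewrite ltr0n ltnW.
have lc : l <= 1 / c3 by rewrite ler_pdivlMr// mulrC ltW.
have nc : n%:R <= expR (1 / c3).
  by rewrite -[leLHS](lnK (_ : n%:R \in Num.pos)) ?posrE// ler_expR.
have E1 : 1 <= E by rewrite -[leLHS](@expR0 R) ler_expR.
have S1 : 1 <= S%:R :> R by rewrite ler1n.
rewrite !div1r in lc nc *.
rewrite mulrA ler_pdivlMr ?mulr_gt0// mul1r.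
apply: (@le_trans _ _ (expR c3^-1 / c3)).
  by apply: ler_pM => //; exact: ltW.
have x0 : 0 <= expR c3^-1 / c3 by apply: divr_ge0 (ltW c0); exact: expR_ge0.
by rewrite ler_peMr// mulr_ege1.
Qed.

Lemma large_sample_bound (K : nat) : 1 <= c3 * l -> K = Num.truncn (c3 * l) ->
  S%:R * (5 * expR (- (2 * l))) + @good_bound R eps n K S
    <= (256 ^+ 2 / c3 ^+ 2 + 8 * 256 / de ^+ 2 + 256 ^+ 2 * 216 * E + 1 / (2 * de) + 5) * T.
Proof.
move=> cl KE; have c0 := degree_const_gt0; have de0 := rate_exp_gt0.
have l0 : 0 < l by exact: ln_nat_gt0.
have n0 : 0 < n%:R :> R by rewrite ltr0n ltnW.
have S0 : 0 < S%:R :> R by rewrite ltr0n.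
have E0 : 0 < E by exact: expR_gt0.
have E1 : 1 <= E by rewrite -[leLHS](@expR0 R) ler_expR.
have nE : n%:R = expR l by rewrite lnK// posrE.
have Kl : K%:R <= c3 * l by rewrite KE truncn_le; lra.
(* Since [K >= 1], rounding down loses at most a factor 2. *)
have Kg : c3 * l / 2 <= K%:R.
  have := truncnS_gt (c3 * l); rewrite -KE -natr1.
  have : 1 <= K%:R :> R by rewrite ler1n KE truncn_gt0.
  lra.
have K0 : 0 < K%:R :> R by apply: lt_le_trans Kg; rewrite divr_gt0// mulr_gt0.
have SE := support_size_ge.
have nl0 : 0 < n%:R * l by rewrite mulr_gt0.
have lede : expR (de * l) <= expR (l / 2).
  rewrite ler_expR mulrC ler_wpM2l ?(ltW l0)//.
  by rewrite -div1r ge_min lexx.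
have coef : 2 ^+ K * (2 * E * expR (2 * K%:R)) ^+ 2 <= 4 * E ^+ 2 * expR (de * l).
  have -> : 2 ^+ K * (2 * E * expR (2 * K%:R)) ^+ 2
      = 4 * E ^+ 2 * (2 ^+ K * expR (2 * K%:R) ^+ 2) by ring.
  rewrite ler_wpM2l ?mulr_ge0 ?sqr_ge0//.
  have -> : expR (2 * K%:R) ^+ 2 = expR (4 * K%:R) :> R.
    by rewrite -expRM_natl; congr expR; ring.
  apply: (@le_trans _ _ (expR K%:R * expR (4 * K%:R))).
    rewrite ler_wpM2r ?expR_ge0// -[K%:R]mulr1 expRM_natl lerXn2r ?nnegrE ?expR_ge0//.
    by have := expR_ge1Dx (1 : R); lra.
  rewrite -expRD ler_expR; move: Kl; rewrite /degree_const; lra.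
have t1 : S%:R * (128 * 128 * E * log_rate n / K%:R ^+ 2) <= 256 ^+ 2 / c3 ^+ 2 * T.
  apply: (@le_trans _ _ (S%:R * (128 * 128 * E * log_rate n / (c3 * l / 2) ^+ 2))).
    have lr0 : 0 <= @log_rate R n by rewrite divr_ge0// ltW.
    rewrite ler_wpM2l ?(ltW S0)//; apply: ler_wpM2l.
      by apply: mulr_ge0 lr0; apply: mulr_ge0 (ltW E0).
    have cl2 : 0 < c3 * l / 2 by rewrite divr_gt0// mulr_gt0.
    by rewrite lef_pV2 ?posrE ?exprn_gt0// lerXn2r ?nnegrE ?(ltW cl2)// ltW.
  rewrite le_eqVlt; apply/orP; left; apply/eqP.
  by rewrite /log_rate; field; rewrite !gt_eqF.
have t2a : 4 * E ^+ 2 * expR (de * l) * (128 * log_rate n) <= 8 * 256 / de ^+ 2 * T.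
  have l2 : l ^+ 2 <= 4 / de ^+ 2 * expR (de * l).
    have := @expr_le_expR R (2 / de) l 2 _ (ltW l0).
    rewrite divr_gt0// => /(_ isT) /le_trans; apply.
    rewrite le_eqVlt; apply/orP; left; apply/eqP; rewrite expr_div_n.
    by congr (_ / _ * expR _); [rewrite -natrX|field; rewrite gt_eqF].
  have H : 2 * 256 * E * l ^+ 2 * expR (de * l) <= 8 * 256 / de ^+ 2 * S%:R.
    apply: (@le_trans _ _ (8 * 256 / de ^+ 2 * (E * expR (2 * de * l)))); last first.
      by apply: ler_wpM2l SE; exact: divr_ge0 (mulr_ge0 (ler0n _ _) (ler0n _ _)) (sqr_ge0 _).
    have -> : 2 * de * l = de * l + de * l by ring.
    rewrite expRD.
    apply: (@le_trans _ _ (2 * 256 * E * (4 / de ^+ 2 * expR (de * l)) * expR (de * l))).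
      apply: ler_wpM2r (expR_ge0 _) _ _ _; apply: ler_wpM2l l2.
      exact: mulr_ge0 (mulr_ge0 (ler0n _ _) (ler0n _ _)) (ltW E0).
    by rewrite le_eqVlt; apply/orP; left; apply/eqP; field; rewrite gt_eqF.
  have -> : 4 * E ^+ 2 * expR (de * l) * (128 * log_rate n)
     = 2 * 256 * E * l ^+ 2 * expR (de * l) * (E / (n%:R * l)).
    by rewrite /log_rate; field; rewrite !gt_eqF.
  have -> : 8 * 256 / de ^+ 2 * T = 8 * 256 / de ^+ 2 * S%:R * (E / (n%:R * l)) by ring.
  by rewrite ler_wpM2r ?divr_ge0 ?(ltW E0) ?(ltW nl0).
have t2b : 4 * E ^+ 2 * expR (de * l) * (S%:R * (128 * log_rate n) ^+ 2)
     <= 256 ^+ 2 * 216 * E * T.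
  (* With [a = 6] the exponent [3 * (l / 6)] is [l / 2]; the other half of the exponent of [n] is
     left for [expR (de * l)]. *)
  have l3 : l ^+ 3 <= 216 * expR (l / 2).
    have := @expr_le_expR R 6 l 3 _ (ltW l0); rewrite ltr0n => /(_ isT) /le_trans; apply.
    rewrite le_eqVlt; apply/orP; left; apply/eqP.
    by congr (_ * expR _); [rewrite -natrX|field].
  have H : expR (de * l) * l ^+ 3 <= 216 * n%:R.
    apply: (@le_trans _ _ (expR (l / 2) * (216 * expR (l / 2)))).
      by rewrite ler_pM ?expR_ge0 ?exprn_ge0 ?(ltW l0).
    rewrite mulrCA -expRD.
    have -> : l / 2 + l / 2 = l by field.
    by rewrite -nE.
  have -> : 4 * E ^+ 2 * expR (de * l) * (S%:R * (128 * log_rate n) ^+ 2)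
     = 256 ^+ 2 * E ^+ 2 * S%:R / (n%:R ^+ 2 * l) * (expR (de * l) * l ^+ 3).
    by rewrite /log_rate; field; rewrite !gt_eqF.
  have -> : 256 ^+ 2 * 216 * E * T
     = 256 ^+ 2 * E ^+ 2 * S%:R / (n%:R ^+ 2 * l) * (216 * n%:R).
    by field; rewrite !gt_eqF.
  apply: ler_wpM2l H; apply: divr_ge0; last exact: mulr_ge0 (sqr_ge0 _) (ltW l0).
  by apply: mulr_ge0 (ltW S0); apply: mulr_ge0 (sqr_ge0 _); exact: sqr_ge0.
have t3 : E ^+ 2 / n%:R <= 1 / (2 * de) * T.
  have H : E * l <= 1 / (2 * de) * S%:R.
    apply: (@le_trans _ _ (1 / (2 * de) * (E * expR (2 * de * l)))); last first.
      by rewrite ler_wpM2l ?divr_ge0 ?mulr_ge0 ?(ltW de0).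
    rewrite mulrCA ler_wpM2l ?(ltW E0)// mulrC mulrA mulr1 ler_pdivlMr ?mulr_gt0//.
    by rewrite mulrC; have := expR_ge1Dx (2 * de * l); lra.
  have -> : E ^+ 2 / n%:R = E * l * (E / (n%:R * l)) by field; rewrite !gt_eqF.
  have -> : 1 / (2 * de) * T = 1 / (2 * de) * S%:R * (E / (n%:R * l)) by ring.
  by rewrite ler_wpM2r ?divr_ge0 ?(ltW E0) ?(ltW nl0).
have t4 : S%:R * (5 * expR (- (2 * l))) <= 5 * T.
  have -> : expR (- (2 * l)) = (n%:R ^+ 2)^-1.
    by rewrite expRN expRM_natl -nE.
  have ln_le : l <= n%:R by rewrite [leRHS]nE; have := expR_ge1Dx l; lra.
  have -> : S%:R * (5 * (n%:R ^+ 2)^-1) = 5 * S%:R / (n%:R ^+ 2 * l) * l.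
    by field; rewrite !gt_eqF.
  have -> : 5 * T = 5 * S%:R / (n%:R ^+ 2 * l) * (E * n%:R).
    by field; rewrite !gt_eqF.
  rewrite ler_wpM2l ?divr_ge0 ?mulr_ge0 ?sqr_ge0 ?(ltW l0)//.
  by rewrite (le_trans ln_le)// ler_peMl// ltW.
have t2 : 2 ^+ K * (2 * E * expR (2 * K%:R)) ^+ 2
      * (128 * log_rate n + S%:R * (128 * log_rate n) ^+ 2)
    <= (8 * 256 / de ^+ 2 + 256 ^+ 2 * 216 * E) * T.
  have lr0 : 0 <= @log_rate R n by rewrite divr_ge0// ltW.
  apply: (@le_trans _ _ (4 * E ^+ 2 * expR (de * l)
      * (128 * log_rate n + S%:R * (128 * log_rate n) ^+ 2))).
    apply: ler_wpM2r coef; apply: addr_ge0; first exact: mulr_ge0.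
    by rewrite mulr_ge0 ?sqr_ge0 ?(ltW S0).
  by rewrite [leLHS]mulrDr [leRHS]mulrDl; exact: lerD.
apply: (le_trans (lerD t4 (lerD (lerD t1 t2) t3))).
set y := T; set z1 := _ / c3 ^+ 2; set z2 := _ / de ^+ 2; set z3 := 1 / (2 * de).
by rewrite le_eqVlt; apply/orP; left; apply/eqP; ring.
Qed.
End rate.

Unset Implicit Arguments.

Theorem corollary4 (R : realType) (C' eps : R) (hC' : 0 < C') (heps : 0 <= eps) :
  exists c1 c2 c3 M : R,
    [/\ c2 < c1, 0 < c2, 0 < c3 & 0 < M] /\
    forall S n : nat, (0 < S)%N -> (2 <= n)%N ->
      ln n%:R <= C' * (ln S%:R - eps) ->
      (ereal_sup [set mean_sq_error eps n (Num.truncn (c3 * ln n%:R)) c1 c2 PQ.1 PQ.2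
                 | PQ in [set: probvec R S * probvec R S]]
        <= (M * (expR eps * S%:R / (n%:R * ln n%:R)))%:E)%E.
Proof.
have de0 := rate_exp_gt0 hC'; have c0 := degree_const_gt0 hC'.
have u0 : 0 < expR (1 / degree_const C') / degree_const C' by rewrite divr_gt0 ?expR_gt0.
have v0 : 0 < 256 ^+ 2 / degree_const C' ^+ 2 + 8 * 256 / rate_exp C' ^+ 2
    + 256 ^+ 2 * 216 * expR eps + 1 / (2 * rate_exp C') + 5.
  have natr_gt0 k : 0 < k.+1%:R :> R by rewrite ltr0n.
  have sqr_gt0 (x : R) : 0 < x -> 0 < x ^+ 2 by move=> x0; rewrite exprn_gt0.
  exact: addr_gt0 (addr_gt0 (addr_gt0 (addr_gt0
    (divr_gt0 (sqr_gt0 _ (natr_gt0 _)) (sqr_gt0 _ c0))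
    (divr_gt0 (mulr_gt0 (natr_gt0 _) (natr_gt0 _)) (sqr_gt0 _ de0)))
    (mulr_gt0 (mulr_gt0 (sqr_gt0 _ (natr_gt0 _)) (natr_gt0 _)) (expR_gt0 _)))
    (divr_gt0 ltr01 (mulr_gt0 (natr_gt0 _) de0))) (natr_gt0 _).
exists 128, 32, (degree_const C'), (rate_const C' eps); split.
  by split=> //; [rewrite ltr_nat|rewrite /rate_const addr_gt0].
move=> S n S0 n1 nS; apply: ge_ereal_sup => _ [[P Q] _ <-] /=.
have T0 : 0 <= expR eps * S%:R / (n%:R * ln n%:R) by exact: target_ge0.
rewrite /rate_const mulrDl.
(* Below 1 the degree is 0 and the bias bound, with [K] in its denominator, says nothing; [n] is
   then bounded in terms of [C']. *)
have [cl|cl] := ltP (degree_const C' * ln n%:R) 1.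
  apply: (le_trans (mean_sq_error_le1 _ _ _ _ _ _ _)); rewrite lee_fin.
  apply: (le_trans (small_sample_bound hC' heps S0 n1 cl)).
  by rewrite lerDr; exact: mulr_ge0 (ltW v0) T0.
set K := Num.truncn _.
have K0 : (0 < K)%N by rewrite truncn_gt0.
have Kl : 2 * K%:R <= 128 * ln n%:R :> R.
  have l0 : 0 < ln n%:R :> R by exact: ln_nat_gt0.
  have : K%:R <= degree_const C' * ln n%:R by rewrite truncn_le; lra.
  have : degree_const C' * ln n%:R <= 1 * ln n%:R.
    rewrite ler_wpM2r ?(ltW l0)// /degree_const.
    have : rate_exp C' <= 1 / 2 by rewrite ge_min lexx.
    by lra.
  lra.
apply: (le_trans (mean_sq_error_le heps n1 K0 Kl P Q)); rewrite lee_fin.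
apply: (le_trans (large_sample_bound hC' heps S0 n1 nS cl erefl)).
by rewrite lerDl; exact: mulr_ge0 (ltW u0) T0.
Qed.
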